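(* Let $n\ge 1$, $V=\mathbb{C}^n$, and let $T=T(V)\otimes T(V^* )$ be the mixed tensor algebra over $V$. Let $S\subseteq T$ and let $G$ be a $*$-subgroup of $\mathrm{GL}(n,\mathbb{C})$ with $\mathcal{U}(n)^S\subseteq G\subseteq \mathrm{GL}(n,\mathbb{C})^S$. Then $T^G$ is equal to the smallest contraction-closed graded $*$-subalgebra of $T$ containing $S\cup\{I\}$, where $I=\sum_{i=1}^n e_i\otimes e_i^*$.
   Context: $T(V)=\bigoplus_{k\ge 0}V^{\otimes k}$, $T(V^* )=\bigoplus_{k\ge 0}V^{*\otimes k}$, and $T=T(V)\otimes T(V^* )\cong\bigoplus_{k,l\ge 0}V^{\otimes k}\otimes V^{*\otimes l}$, with multiplication (also written $\otimes$) $(x\otimes y)\otimes(x'\otimes y')=(x\otimes x')\otimes(y\otimes y')$ for $x,x'\in T(V)$, $y,y'\in T(V^* )$. For $U\in \mathrm{GL}(n,\mathbb{C})$, $z\mapsto z^U$ is the unique algebra endomorphism of $T$ with $x^U=Ux$ for $x\in V$ and $y^U=(U^{\mathsf T})^{-1}y$ for $y\in V^*$ (coordinates with respect to the dual basis; i.e. $y^U=y\circ U^{-1}$). For $G\subseteq \mathrm{GL}(n,\mathbb{C})$, $T^G:=\{z\in T\mid z^U=z \text{ for all } U\in G\}$. For $S\subseteq T$ and $K\subseteq\mathrm{GL}(n,\mathbb{C})$, $K^S:=\{U\in K\mid z^U=z\text{ for all }z\in S\}$. $\mathcal{U}(n)$ is the unitary group. A subgroup $G$ of $\mathrm{GL}(n,\mathbb{C})$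 is a $*$-subgroup if $G=G^*:=\{U^*\mid U\in G\}$ ($U^*$ the conjugate transpose). Graded: for $A\subseteq T$ put $A_{k,l}:=A\cap(V^{\otimes k}\otimes V^{*\otimes l})$; a subalgebra $A$ of $T$ is graded if $A=\bigoplus_{k,l\ge0}A_{k,l}$. $*$-operation: let $e_1,\ldots,e_n$ be the standard basis of $V$ and $e_1^*,\ldots,e_n^*$ the dual basis of $V^*$. The map $e_i\mapsto e_i^*$ extends to a unique function $x\mapsto x^*$ on $T$ with $(x^* )^*=x$, $(\lambda x)^*=\overline{\lambda}x^*$, $(x+y)^*=x^*+y^*$, $(x\otimes y)^*=y^*\otimes x^*$ for all $x,y\in T$, $\lambda\in\mathbb{C}$. A subalgebra $A$ of $T$ is a $*$-subalgebra if $A^*=A$. Contraction-closed: a graded subalgebra is contraction-closed if it is closed under all contraction operators $V^{\otimes k}\otimes V^{*\otimes l}\to V^{\otimes (k-1)}\otimes V^{*\otimes (l-1)}$ ($k,l\ge1$) that pair the $i$-th $V$-factor with the $j$-th $V^*$-factor, $1\le i\le k$, $1\le j\le l$. *)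

(* Defs.v *)
From HB Require Import structures.
From mathcomp Require Import all_boot all_order all_algebra spectral.
From mathcomp Require Import finmap classical_sets.
From mathcomp Require Import monalg.

Set Implicit Arguments.
Unset Strict Implicit.
Unset Printing Implicit Defensive.

Import Order.TTheory GRing.Theory Num.Theory.

Local Open Scope ring_scope.
Local Open Scope sesquilinear_scope.
Local Open Scope classical_set_scope.

(* The pair of words (i_1 .. i_k, j_1 .. j_l) indexes the basis tensor
   e_{i_1} (x) .. (x) e_{i_k} (x) e*_{j_1} (x) .. (x) e*_{j_l} of
   V^{(x) k} (x) V*^{(x) l}.  Multiplication in T(V) (x) T(V* ) concatenates the
   two words separately, so T is the algebra of the product of two free monoids
   on n letters. *)
Definition biword (n : nat) := (seq 'I_n * seq 'I_n)%type.

HB.instance Definition _ n := Choice.on (biword n).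

Definition bione n : biword n := ([::], [::]).
Definition bimul n (w w' : biword n) : biword n := (w.1 ++ w'.1, w.2 ++ w'.2).

Fact bimulA n : associative (@bimul n).
Proof. by move=> a b c; rewrite /bimul /= !catA. Qed.
Fact bimul1w n : left_id (@bione n) (@bimul n).
Proof. by case. Qed.
Fact bimulw1 n : right_id (@bione n) (@bimul n).
Proof. by case=> a b; rewrite /bimul /= !cats0. Qed.
Fact bimul_unit n (x y : biword n) :
  bimul x y = bione n -> x = bione n /\ y = bione n.
Proof. by case: x y => [[|? ?] [|? ?]] [[|? ?] [|? ?]]. Qed.

HB.instance Definition _ n :=
  Choice_isMonomialDef.Build (biword n)
    (@bimulA n) (@bimul1w n) (@bimulw1 n) (@bimul_unit n).

Notation mtensor C n := {malg C[biword n]}.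

Section MixedTensorAlgebra.
Context {C : numClosedFieldType} {n : nat}.
Local Notation T := (mtensor C n).

Definition btensor (w : biword n) : T := << w >>.

Definition vec (x : 'cV[C]_n) : T :=
  \sum_(i < n) x i ord0 *: btensor ([:: i], [::]).
(* A column vector y stands here for the covector \sum_i y_i e*_i. *)
Definition covec (y : 'cV[C]_n) : T :=
  \sum_(i < n) y i ord0 *: btensor ([::], [:: i]).

Definition std (i : 'I_n) : 'cV[C]_n := delta_mx i ord0.

Definition idtensor : T := \sum_(i < n) vec (std i) * covec (std i).

(* z ^ U *)
Definition actw (U : 'M[C]_n) (w : biword n) : T :=
  (\prod_(i <- w.1) vec (U *m std i)) *
  (\prod_(j <- w.2) covec (invmx U^T *m std j)).
Definition act (U : 'M[C]_n) (z : T) : T := mmap malgC (actw U) z.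

(* z^* : since V and V* commute in T, reversing a product exchanges the two
   words and reverses each of them. *)
Definition star (z : T) : T :=
  mmap (malgC \o Num.conj)
       (fun w => btensor (rev w.2, rev w.1)) z.

Definition GL : set 'M[C]_n := [set U | U \in unitmx].
Definition unitary : set 'M[C]_n := [set U | U \is unitarymx].

Definition is_subgroup (G : set 'M[C]_n) :=
  [/\ G `<=` GL, G 1%:M, forall U W, G U -> G W -> G (U *m W)
    & forall U, G U -> G (invmx U)].
Definition is_star_subgroup (G : set 'M[C]_n) :=
  is_subgroup G /\ G = [set U ^t* | U in G].

(* T^G *)
Definition invariants (G : set 'M[C]_n) : set T :=
  [set z | forall U, G U -> act U z = z].
(* K^S *)
Definition stabilizer (K : set 'M[C]_n) (S : set T) : set 'M[C]_n :=
  [set U | K U /\ forall z, S z -> act U z = z].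

Definition bihom (k l : nat) : set T :=
  [set z | forall w, w \in msupp z -> size w.1 = k /\ size w.2 = l].

(* Unital subalgebras; requiring the unit makes no difference for algebras that
   contain idtensor and are closed under contraction when 0 < n. *)
Definition is_subalgebra (A : set T) := GRing.subalg_closed (mem A).

(* A is the sum of the A_{k,l}; directness holds already in T. *)
Definition is_graded (A : set T) :=
  A = [set z | exists N (x : nat -> nat -> T),
         (forall k l, (A `&` bihom k l) (x k l)) /\
         z = \sum_(k < N) \sum_(l < N) x k l].

Definition is_star_closed (A : set T) := A = star @` A.

Definition delete (i : nat) (s : seq 'I_n) := take i s ++ drop i.+1 s.

(* Pairs the i-th V-factor with the j-th V*-factor, counting from 0; meaningful
   on bihom k l for i < k and j < l only. *)
Definition contract (i j : nat) (z : T) : T :=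
  mmap malgC (fun w => if onth w.1 i == onth w.2 j
                       then btensor (delete i w.1, delete j w.2) else 0) z.

Definition is_contraction_closed (A : set T) :=
  forall (k l : nat) (i : 'I_k) (j : 'I_l) z,
    (A `&` bihom k l) z -> A (contract i j z).

Definition is_ccg_star_subalgebra (A : set T) :=
  [/\ is_subalgebra A, is_graded A, is_star_closed A & is_contraction_closed A].

End MixedTensorAlgebra.

Lemma prod_biword (A : nzRingType) n (f g : 'I_n -> A) (w w' : biword n) :
  (forall i j, f i * g j = g j * f i) ->
  (\prod_(i <- w.1 ++ w'.1) f i) * (\prod_(j <- w.2 ++ w'.2) g j) =
  ((\prod_(i <- w.1) f i) * (\prod_(j <- w.2) g j)) *
  ((\prod_(i <- w'.1) f i) * (\prod_(j <- w'.2) g j)).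
Proof.
move=> fg; rewrite !big_cat /= -!mulrA; congr (_ * _); rewrite !mulrA.
congr (_ * _); symmetry; apply: commr_prod => i _; apply/commr_sym.
by apply: commr_prod => j _; exact: fg.
Qed.

Section Checks.
Context {C : numClosedFieldType} {n : nat}.
Local Notation T := (mtensor C n).
Implicit Types (x y z : T) (w : biword n) (U : 'M[C]_n).

Lemma btensorM w w' : btensor w * btensor w' = btensor (bimul w w') :> T.
Proof. by rewrite /btensor malgM_def fgmulUU mulr1. Qed.

Lemma btensor1 : btensor (bione n) = 1 :> T.
Proof. by []. Qed.

Lemma malg_comm (c : C) z : c%:MP * z = z * c%:MP.
Proof.
rewrite mul_malgC; apply/malgP=> w; rewrite mcoeffZ malgM_def fgmulgU.
rewrite raddf_sum /= {1}[z]monalgE raddf_sum mulr_sumr /=.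
by apply: eq_bigr => v _; rewrite !mcoeffU mulrnAr mulm1 mulrC.
Qed.

Lemma scaler_mtensorAr (c : C) x y : x * (c *: y) = c *: (x * y).
Proof. by rewrite -!mul_malgC mulrA -malg_comm -mulrA. Qed.

Lemma mtensorE z : z = \sum_(w <- msupp z) z@_w *: btensor w.
Proof.
rewrite {1}[z]monalgE; apply: eq_bigr => w _.
by apply/malgP=> v; rewrite mcoeffZ !mcoeffU mulrnAr mulr1.
Qed.

Lemma vec_std i : vec (std i) = btensor ([:: i], [::]) :> T.
Proof.
rewrite /vec (bigD1 i) //= big1 => [|j /negbTE ji];
  by rewrite /std mxE ?ji ?eqxx ?scale1r ?addr0 ?scale0r.
Qed.

Lemma covec_std i : covec (std i) = btensor ([::], [:: i]) :> T.
Proof.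
rewrite /covec (bigD1 i) //= big1 => [|j /negbTE ji];
  by rewrite /std mxE ?ji ?eqxx ?scale1r ?addr0 ?scale0r.
Qed.

Lemma vec_covec_comm (a b : 'cV[C]_n) : vec a * covec b = covec b * vec a :> T.
Proof.
transitivity (\sum_(i < n) \sum_(j < n)
    (a i ord0 * b j ord0) *: btensor ([:: i], [:: j]) : T).
  rewrite /vec mulr_suml; apply: eq_bigr => i _.
  rewrite /covec mulr_sumr; apply: eq_bigr => j _.
  by rewrite -scalerAl scaler_mtensorAr btensorM /bimul /= scalerA.
rewrite exchange_big /= /covec mulr_suml; apply: eq_bigr => j _.
rewrite /vec mulr_sumr; apply: eq_bigr => i _.
by rewrite -scalerAl scaler_mtensorAr btensorM /bimul /= scalerA mulrC.
Qed.

Lemma btensor_prod w : btensor w =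
  (\prod_(i <- w.1) vec (std i)) * (\prod_(j <- w.2) covec (std j)) :> T.
Proof.
case: w => u v /=.
have -> : (u, v) = bimul (u, [::]) ([::], v) by rewrite /bimul /= cats0.
rewrite -btensorM; congr (_ * _).
  elim: u => [|i u IH]; first by rewrite big_nil.
  by rewrite big_cons -IH vec_std btensorM.
elim: v => [|i v IH]; first by rewrite big_nil.
by rewrite big_cons -IH covec_std btensorM.
Qed.

Lemma actD U x y : act U (x + y) = act U x + act U y.
Proof. exact: mmapD. Qed.

Lemma act_btensor U w : act U (btensor w) = actw U w.
Proof. by rewrite /act mmapU mul1r. Qed.

Lemma actZ U (c : C) z : act U (c *: z) = c *: act U z.
Proof.
rewrite /act (mmapEw (msuppZ_le _ _)) mmapE scaler_sumr.
apply: eq_bigr => w _.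
by rewrite mcoeffZ /= mpolyCM -mulrA; exact: mul_malgC.
Qed.

Lemma act1 U : act U 1 = 1.
Proof. by rewrite -[in LHS]btensor1 act_btensor /actw /= [X in X * _]big_nil mul1r big_nil. Qed.

Lemma actwM U w w' : actw U (bimul w w') = actw U w * actw U w'.
Proof. by apply: prod_biword => i j; exact: vec_covec_comm. Qed.

Fact actw_mmorphism U : mmorphism (actw U : biword n -> T).
Proof.
split=> [w w'|]; first exact: actwM.
by have := act_btensor U (bione n); rewrite btensor1 act1 => <-.
Qed.
HB.instance Definition _ U :=
  monalg.isMultiplicative.Build (biword n) T (actw U) (actw_mmorphism U).

Lemma actM U x y : act U (x * y) = act U x * act U y.
Proof.
have [|h _] := @commr_mmap_is_multiplicative (biword n) C T malgC (actw U).
  by move=> g w w'; exact: malg_comm.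
exact: h.
Qed.

Lemma act_sum U I (r : seq I) (F : I -> T) :
  act U (\sum_(i <- r) F i) = \sum_(i <- r) act U (F i).
Proof. exact: raddf_sum. Qed.

Lemma mulmx_std (M : 'M[C]_n) i k : (M *m std i) k ord0 = M k i.
Proof.
rewrite mxE (bigD1 i) //= big1 ?addr0 => [|j ji].
  by rewrite [std _ _ _]mxE !eqxx mulr1.
by rewrite [std _ _ _]mxE (negbTE ji) mulr0.
Qed.

Lemma act_vec U (a : 'cV[C]_n) : act U (vec a) = vec (U *m a).
Proof.
rewrite [in LHS]/vec act_sum.
transitivity (\sum_(i < n) \sum_(k < n)
    (U k i * a i ord0) *: btensor ([:: k], [::]) : T).
  apply: eq_bigr => i _; rewrite actZ act_btensor /actw big_nil mulr1 big_seq1.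
  rewrite /vec scaler_sumr; apply: eq_bigr => k _.
  by rewrite scalerA mulmx_std mulrC.
rewrite exchange_big /=; apply: eq_bigr => k _.
by rewrite mxE scaler_suml.
Qed.

Lemma act_covec U (b : 'cV[C]_n) : act U (covec b) = covec (invmx U^T *m b).
Proof.
rewrite [in LHS]/covec act_sum; set W := invmx _.
transitivity (\sum_(i < n) \sum_(k < n)
    (W k i * b i ord0) *: btensor ([::], [:: k]) : T).
  apply: eq_bigr => i _; rewrite actZ act_btensor /actw big_nil mul1r big_seq1.
  rewrite /covec scaler_sumr; apply: eq_bigr => k _.
  by rewrite scalerA mulmx_std mulrC.
rewrite exchange_big /=; apply: eq_bigr => k _.
by rewrite mxE scaler_suml.
Qed.

Lemma act_unique U (f : T -> T) :
  (forall (c : C) x y, f (c *: x + y) = c *: f x + f y) ->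
  (forall x y, f (x * y) = f x * f y) -> f 1 = 1 ->
  (forall a, f (vec a) = vec (U *m a)) ->
  (forall b, f (covec b) = covec (invmx U^T *m b)) ->
  forall z, f z = act U z.
Proof.
move=> fL fM f1 fv fc z.
have f0 : f 0 = 0.
  by have := fL (-1) 0 0; rewrite scaleN1r oppr0 add0r scaleN1r addNr.
rewrite [in LHS](mtensorE z) /act mmapE.
elim: (enum_fset (msupp z)) => [|w s IH]; first by rewrite !big_nil.
rewrite !big_cons fL IH; congr (_ + _); rewrite mul_malgC; congr (_ *: _).
rewrite btensor_prod fM /actw; congr (_ * _).
  by rewrite (big_morph f fM f1); apply: eq_bigr => i _; exact: fv.
by rewrite (big_morph f fM f1); apply: eq_bigr => i _; exact: fc.
Qed.

Lemma starE z w : (star z)@_w = Num.conj (z@_(rev w.2, rev w.1)).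
Proof.
rewrite /star mmapE raddf_sum /= [in RHS](monalgE z) raddf_sum rmorph_sum /=.
apply: eq_bigr => v _.
rewrite mul_malgC mcoeffZ !mcoeffU rmorphMn /= mulr_natr.
congr (_ *+ _); congr nat_of_bool; apply/eqP/eqP => [<-|->];
  by rewrite /= !revK -surjective_pairing.
Qed.

Lemma starK z : star (star z) = z.
Proof. by apply/malgP => -[u v]; rewrite !starE /= !revK conjCK. Qed.

Lemma starD x y : star (x + y) = star x + star y.
Proof. exact: mmapD. Qed.

Lemma starZ (c : C) z : star (c *: z) = Num.conj c *: star z.
Proof. by apply/malgP => w; rewrite [RHS]mcoeffZ [LHS]starE [X in _ * X]starE mcoeffZ rmorphM. Qed.

Lemma star_btensor w : star (btensor w) = btensor (rev w.2, rev w.1) :> T.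
Proof.
apply/malgP => -[u v]; rewrite starE !mcoeffU rmorph_nat /=; congr (_ %:R).
by congr nat_of_bool; apply/eqP/eqP => [->|[<- <-]] /=; rewrite !revK //; case: w.
Qed.

Lemma star_sum I (r : seq I) (F : I -> T) :
  star (\sum_(i <- r) F i) = \sum_(i <- r) star (F i).
Proof.
apply: (big_morph _ starD); apply/malgP => w.
by rewrite starE !mcoeff0 rmorph0.
Qed.

Lemma star_expand z :
  star z = \sum_(w <- msupp z) Num.conj z@_w *: btensor (rev w.2, rev w.1).
Proof. by apply: eq_bigr => w _; exact: mul_malgC. Qed.

Lemma mulr_expand x y : x * y = \sum_(v <- msupp x) \sum_(w <- msupp y)
  (x@_v * y@_w) *: btensor (bimul v w).
Proof.
rewrite malgME; apply: eq_bigr => v _; apply: eq_bigr => w _.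
by apply/malgP => u; rewrite mcoeffZ !mcoeffU mulrnAr mulr1.
Qed.

Lemma starM x y : star (x * y) = star y * star x.
Proof.
rewrite mulr_expand star_sum (star_expand x) mulr_sumr; apply: eq_bigr => v _.
rewrite star_sum (star_expand y) mulr_suml; apply: eq_bigr => w _.
rewrite starZ star_btensor -scalerAl scaler_mtensorAr btensorM scalerA.
by rewrite /bimul /= !rev_cat rmorphM mulrC.
Qed.

Lemma star_vec_std i : star (vec (std i)) = covec (std i) :> T.
Proof. by rewrite vec_std covec_std star_btensor. Qed.

Lemma contract_btensor i j w : contract i j (btensor w) =
  (if onth w.1 i == onth w.2 j then btensor (delete i w.1, delete j w.2) else 0)
  :> T.
Proof. by rewrite /contract mmapU mul1r. Qed.

Definition hcomp (k l : nat) z : T :=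
  \sum_(w <- msupp z | (size w.1 == k) && (size w.2 == l)) z@_w *: btensor w.

Lemma hcompE k l z w :
  (hcomp k l z)@_w = if (size w.1 == k) && (size w.2 == l) then z@_w else 0.
Proof.
rewrite /hcomp raddf_sum /=.
case: ifP => sw; last first.
  apply: big1 => v sv; rewrite mcoeffZ mcoeffU; case: eqP => [vw|_].
    by rewrite vw sw in sv.
  by rewrite mulr0.
rewrite [in RHS](mtensorE z) raddf_sum /= [in RHS](bigID (fun v : biword n =>
  (size v.1 == k) && (size v.2 == l))) /= [X in _ = _ + X]big1 ?addr0 // => v sv.
rewrite mcoeffZ mcoeffU; case: eqP => [vw|_]; last by rewrite mulr0.
by rewrite vw sw in sv.
Qed.

Lemma bihomE k l z w : bihom k l z ->
  z@_w = if (size w.1 == k) && (size w.2 == l) then z@_w else 0.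
Proof.
move=> zkl; case: ifP => // /negbT sw; apply: mcoeff_outdom.
by apply: contraNN sw => /zkl [-> ->]; rewrite !eqxx.
Qed.

Lemma hcomp_bihom k l z : bihom k l (hcomp k l z).
Proof.
by move=> w; rewrite -mcoeff_neq0 hcompE; case: ifP => [/andP[/eqP-> /eqP->]|_ /eqP].
Qed.

Lemma hcomp_sum z : exists N, forall M, (N <= M)%N ->
  z = \sum_(k < M) \sum_(l < M) hcomp k l z.
Proof.
pose N := (\max_(w <- msupp z) maxn (size w.1) (size w.2)).+1.
exists N => M NM; apply/malgP => w; rewrite raddf_sum /=.
under eq_bigr do rewrite raddf_sum /=.
have [wz|wz] := boolP (w \in msupp z); last first.
  rewrite (mcoeff_outdom wz) big1 // => k _; rewrite big1 // => l _.
  by rewrite hcompE (mcoeff_outdom wz) if_same.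
have : (maxn (size w.1) (size w.2) < M)%N.
  apply: leq_trans NM; rewrite ltnS.
  exact: (@leq_bigmax_seq _ _ _ (fun v : biword n => maxn (size v.1) (size v.2)) _ wz).
rewrite gtn_max => /andP[h1 h2].
rewrite (bigD1 (Ordinal h1)) //= [X in _ = _ + X]big1 ?addr0; last first.
  move=> k kw; rewrite big1 // => l _; rewrite hcompE.
  case: eqP => // wk; case/eqP: kw; exact: val_inj.
rewrite (bigD1 (Ordinal h2)) //= [X in _ = _ + X]big1 ?addr0; last first.
  move=> l lw; rewrite hcompE; case: (_ =P nat_of_ord l) => [wl|]; last by rewrite andbF.
  case/eqP: lw; exact: val_inj.
by rewrite hcompE !eqxx.
Qed.

Lemma subalgebra_sum (A : set T) I (r : seq I) (F : I -> T) :
  is_subalgebra A -> (forall i, A (F i)) -> A (\sum_(i <- r) F i).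
Proof.
case=> A1 AL _ AF.
have AD x y : A x -> A y -> A (x + y).
  move=> Ax Ay; have := AL 1 x y; rewrite scale1r.
  by move=> h; apply/set_mem; apply: h; apply/mem_set.
have A0 : A 0.
  apply/set_mem; have := AL (-1) 1 1 A1 A1.
  by rewrite scaleN1r addNr.
by apply: (big_ind A).
Qed.

Lemma gradedP (A : set T) : is_subalgebra A ->
  is_graded A <-> (forall k l z, A z -> A (hcomp k l z)).
Proof.
move=> Aalg; split => [gA k l z | hA].
  rewrite {1}gA => -[N [x [Ax ->]]].
  suff -> : hcomp k l (\sum_(i < N) \sum_(j < N) x i j) =
            \sum_(i < N) \sum_(j < N) hcomp k l (x i j).
    apply: subalgebra_sum => // i; apply: subalgebra_sum => // j.
    have [/eqP[<- <-]|kl] := boolP ((i : nat, j : nat) == (k, l)).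
      suff -> : hcomp i j (x i j) = x i j by exact: (Ax i j).1.
      by apply/malgP => w; rewrite hcompE -bihomE //; exact: (Ax i j).2.
    suff -> : hcomp k l (x i j) = 0.
      have := @subalgebra_sum A nat [::] (fun=> 1) Aalg; rewrite big_nil; apply.
      by move=> _; apply/set_mem; case: Aalg.
    apply/malgP => w; rewrite hcompE mcoeff0.
    rewrite (bihomE w (Ax i j).2); case: ifP => // /andP[/eqP wk /eqP wl].
    case: ifP => // /andP[/eqP wi /eqP wj].
    by rewrite -wi -wj wk wl eqxx in kl.
  apply/malgP => w; rewrite hcompE !raddf_sum /=.
  case: ifP => sw; [|symmetry; apply: big1 => i _; rewrite raddf_sum big1 // => j _].
    by apply: eq_bigr => i _; rewrite !raddf_sum /=; apply: eq_bigr => j _;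
       rewrite hcompE sw.
  by rewrite /= hcompE sw.
apply/seteqP; split => z.
  move=> Az; have [N zN] := hcomp_sum z.
  exists N, (fun k l => hcomp k l z); split => [k l|]; last exact: zN.
  by split; [exact: hA | exact: hcomp_bihom].
case=> N [x [Ax ->]].
by apply: subalgebra_sum => // i; apply: subalgebra_sum => // j; exact: (Ax i j).1.
Qed.

(* Hence smallest is_ccg_star_subalgebra S, defined as an intersection, is the
   least contraction-closed graded *-subalgebra containing S. *)
Lemma smallest_ccg_star_subalgebra (S : set T) :
  is_ccg_star_subalgebra (smallest is_ccg_star_subalgebra S).
Proof.
set B := smallest _ S.
have Balg : is_subalgebra B.
  split.
  - by apply/mem_set => A [[[A1 _ _] _ _ _] _]; apply/set_mem.
  - move=> c x y /set_mem Bx /set_mem By; apply/mem_set => A hA.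
    have [[[_ AL _] _ _ _] _] := hA; apply/set_mem.
    by apply: AL; apply/mem_set; [exact: Bx | exact: By].
  - move=> x y /set_mem Bx /set_mem By; apply/mem_set => A hA.
    have [[[_ _ AM] _ _ _] _] := hA; apply/set_mem.
    by apply: AM; apply/mem_set; [exact: Bx | exact: By].
have Bstar z : B z -> B (star z).
  move=> Bz A hA; have [[_ _ sA _] _] := hA.
  by rewrite sA; exists z => //; exact: Bz.
split=> //.
- apply/(gradedP Balg) => k l z Bz A hA; have [[Aalg gA _ _] _] := hA.
  exact: (gradedP Aalg).1 gA k l z (Bz A hA).
- apply/seteqP; split => [z Bz|_ [z Bz <-]]; last exact: Bstar.
  by exists (star z); [exact: Bstar | exact: starK].
- move=> k l i j z [Bz zkl] A hA; have [[_ _ _ cA] _] := hA.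
  by apply: (cA k l); split => //; exact: Bz.
Qed.

End Checks.

(* Main.v *)
Require Import Defs.
From HB Require Import structures.
From mathcomp Require Import all_boot all_order all_algebra spectral.
From mathcomp Require Import finmap complex.
From mathcomp Require Import classical_sets boolp reals topology.
From mathcomp Require Import -(notations) normedtype derive.
From mathcomp Require Import monalg.
From mathcomp Require Import ring lra.

Set Implicit Arguments.
Unset Strict Implicit.
Unset Printing Implicit Defensive.

Import numFieldNormedType.Exports.
Import Order.TTheory GRing.Theory Num.Theory.
Local Open Scope ring_scope.
Local Open Scope classical_set_scope.

(** The invariants of G are closed under all the operations, because G preserves
    bidegrees and contractions, and because act U (star z) = star (act V z) for
    V the inverse of the conjugate transpose of U, which lies in G with U
    ([invariants_ccg]).  They contain S and the identity tensor, hence the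
    smallest such algebra A.

    For the converse it is enough that every homogeneous tensor z outside A is
    moved by some unitary matrix U that fixes all of A ([separation]): such a U
    fixes S, so it lies in G and z is not invariant.  The matrix is found by
    building the expectation that integration over the group of unitary matrices
    fixing A would give, without knowing that group.  For a compact group the
    average of the operators by which it acts on V^k (x) V*^l is the orthogonal
    projection on the invariants.  So let ker be the matrix of the orthogonal
    projection of each V^k (x) V*^l onto its intersection with A, and define a
    linear functional E on polynomials in the entries of a matrix and their
    conjugates by letting the entries of ker be the expectations of the monomials
    ([moment], [expectation]).

    - E is well defined on commuting variables because A is stable under
      permutations of the tensor factors, which are obtained by multiplying with
      the identity tensor and contracting ([piece_swap], [ker_swap]).
    - E is positive.  This is the main point.  Reading a tensor of shape s + t^* as
      an operator from shape t to shape s, A becomes an algebra of operators stable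
      under composition ([piece_comp]) and adjoints.  If b runs over an orthonormal
      basis of A, then X |-> sum_b b X b^* is self-adjoint with values in the
      commutant of A, so its quadratic form at X equals its quadratic form at the
      projection of X on the commutant, where it is a sum of norms
      ([commutant_pos], [average_pos], [ker_pos]).
    - E kills the ideal of the relations saying that a matrix U fixes the elements
      of A ([fix_equation_null]).  For the identity tensor these relations say
      that U is unitary, so the variables are bounded for E.
    - E does not kill the relation saying that U fixes z, as soon as z differs
      from its projection on A ([expectation_fix_equation]).

    If such a functional does not vanish on a polynomial q, then some point satisfies
    all the relations it kills without being a zero of q ([character_exists]).
    Indeed the set of normalized positive functionals with given bounds and given
    relations is compact by Tychonoff's theorem.  A functional L maximizing the value
    of a hermitian element h with maximum c satisfies L (h p) = c L (p) for every p:
    the form L ((c - h) p q^* ) is positive semidefinite, since otherwise a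
    localization of L would exceed the maximum, and it vanishes at p = q = 1, so
    Cauchy-Schwarz applies.  Maximizing first a hermitian element built from q and
    then the real and imaginary parts of the entries one after the other makes all
    of them act as constants; these constants are the entries of U. *)

(** * States of a commutative algebra with involution *)

Section States.
Context {R : realType} {AA : comNzRingType} (iota : {rmorphism R -> AA})
  (s : {rmorphism AA -> AA}) (B : AA -> R).
Hypotheses (sK : involutive s) (s_iota : forall r, s (iota r) = iota r).

(** A state is a normalized positive functional, here with a priori bounds [B]
    and with a set [Z] of relations that it kills together with the ideal they
    generate.  The bounds are imposed on all weights [q * s q] so that they pass to
    the localizations of a state. *)
Record state (Z : AA -> Prop) (L : AA -> R) : Prop := State {
  state_lin : forall r p q, L (iota r * p + q) = r * L p + L q;
  state1 : L 1 = 1;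
  state_herm : forall p, L (s p) = L p;
  state_pos : forall p, 0 <= L (p * s p);
  state_bnd : forall p q, L (q * s q * (p * s p)) <= B p * L (q * s q);
  state_null : forall g p, Z g -> L (g * p) = 0 }.

Section Linear.
Context (Z : AA -> Prop) (L : AA -> R) (stL : state Z L).

Lemma stateD p q : L (p + q) = L p + L q.
Proof. by have := state_lin stL 1 p q; rewrite rmorph1 !mul1r. Qed.

Lemma state0 : L 0 = 0.
Proof. by apply: (addIr (L 0)); rewrite -stateD !add0r. Qed.

Lemma stateZ r p : L (iota r * p) = r * L p.
Proof. by have := state_lin stL r p 0; rewrite state0 !addr0. Qed.

Lemma stateN p : L (- p) = - L p.
Proof. by have := stateZ (-1) p; rewrite rmorphN1 !mulN1r. Qed.

Lemma stateB p q : L (p - q) = L p - L q.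
Proof. by rewrite stateD stateN. Qed.

(** The form (p, q) |-> L (h * p * s q) is symmetric and positive semidefinite;
    this is its Cauchy-Schwarz inequality at the pair (1, p). *)
Lemma state_cauchy_schwarz h p : s h = h -> (forall q, 0 <= L (h * (q * s q))) ->
  L (h * p) ^+ 2 <= L h * L (h * (p * s p)).
Proof.
move=> hh hpos.
set a := L h; set b := L (h * p); set c := L (h * (p * s p)).
have quad t u : 0 <= t ^+ 2 * a + 2 * t * u * b + u ^+ 2 * c.
  have := hpos (iota t + iota u * p).
  rewrite rmorphD rmorphM !s_iota.
  have -> : h * ((iota t + iota u * p) * (iota t + iota u * s p)) =
    iota (t ^+ 2) * h + (iota (t * u) * (h * p) +
     (iota (t * u) * (h * s p) + iota (u ^+ 2) * (h * (p * s p)))).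
    by rewrite ?expr2 !rmorphM; ring.
  rewrite !(state_lin stL) stateZ -[L (h * s p)](state_herm stL) rmorphM sK hh.
  by rewrite -/a -/b -/c; congr (_ <= _); ring.
have c0 : 0 <= c by exact: hpos.
(* The quadratic form is evaluated at (c, - b), or at (b, - (a + 1) / 2) if c = 0. *)
have [c1|] := ltP 0 c.
  have := quad c (- b); have -> : c ^+ 2 * a + 2 * c * - b * b + (- b) ^+ 2 * c =
    c * (a * c - b ^+ 2) by ring.
  by rewrite pmulr_rge0 // subr_ge0.
move=> c1; have c2 : c = 0 by apply/eqP; rewrite eq_le c0 c1.
have := quad b (- (a + 1) / 2); rewrite c2 !mulr0 addr0.
have -> : b ^+ 2 * a + 2 * b * (- (a + 1) / 2) * b = - b ^+ 2 by field.
by rewrite oppr_ge0.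
Qed.

End Linear.

(** Localization corresponds to multiplying a measure by the density [q * s q]. *)
Lemma state_localize Z L q : state Z L -> 0 < L (q * s q) ->
  state Z (fun p => L (q * s q * p) / L (q * s q)).
Proof.
move=> stL q0; split => [r p p'||p|p|p p'|g p Zg].
- have -> : q * s q * (iota r * p + p') =
     iota r * (q * s q * p) + q * s q * p' by ring.
  by rewrite (state_lin stL) mulrDl mulrA.
- by rewrite mulr1 divff // gt_eqF.
- congr (_ / _); rewrite -[LHS](state_herm stL) !rmorphM !sK.
  by congr L; ring.
- apply: divr_ge0; last exact: ltW.
  have -> : q * s q * (p * s p) = (q * p) * s (q * p) by rewrite rmorphM; ring.
  exact: (state_pos stL).
- rewrite [leRHS]mulrA ler_pM2r ?invr_gt0 //.
  have -> : q * s q * (p' * s p') = (q * p') * s (q * p') by rewrite rmorphM; ring.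
  have -> : q * s q * (p' * s p' * (p * s p)) =
            (q * p') * s (q * p') * (p * s p) by rewrite rmorphM; ring.
  exact: (state_bnd stL).
- have -> : q * s q * (g * p) = g * (q * s q * p) by ring.
  by rewrite (state_null stL) // mul0r.
Qed.

(** If L maximizes the value of h, then L is positive on (c - h) * q * s q, since
    otherwise the localization of L at q would give h a value above c.  Since
    L (c - h) = 0, Cauchy-Schwarz makes the relation h = c hold for L. *)
Lemma state_maximum Z L h c : s h = h -> state Z L -> L h = c ->
  (forall L', state Z L' -> L' h <= c) ->
  state (fun g => Z g \/ g = h - iota c) L.
Proof.
move=> hh stL Lh cmax.
have hc : s (iota c - h) = iota c - h by rewrite rmorphB s_iota hh.
have pos q : 0 <= L ((iota c - h) * (q * s q)).
  have -> : (iota c - h) * (q * s q) = iota c * (q * s q) - q * s q * h by ring.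
  rewrite (stateB stL) (stateZ stL) subr_ge0.
  have := state_pos stL q; rewrite le_eqVlt => /orP[/eqP q0|q0].
    have qh : s (q * s q) = q * s q by rewrite rmorphM sK mulrC.
    have qpos p : 0 <= L (q * s q * (p * s p)).
      have -> : q * s q * (p * s p) = (q * p) * s (q * p).
        by rewrite rmorphM; ring.
      exact: (state_pos stL).
    have := state_cauchy_schwarz stL h qh qpos.
    by rewrite -q0 mul0r mulr0 exprn_even_le0 //= => /eqP ->.
  rewrite -ler_pdivrMr //.
  exact: (cmax (fun p => L (q * s q * p) / L (q * s q)) (state_localize stL q0)).
split; try by case: stL.
move=> g p [Zg|->]; first exact: (state_null stL).
have := state_cauchy_schwarz stL p hc pos.
have -> : L (iota c - h) = 0.
  by rewrite (stateB stL) -[iota c]mulr1 (stateZ stL) (state1 stL) mulr1 Lh subrr.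
rewrite mul0r exprn_even_le0 //= => /eqP Lp.
by rewrite -opprB mulNr (stateN stL) Lp oppr0.
Qed.

(** The bound turns the set of states into a subset of a product of segments. *)
Lemma state_le Z L p : state Z L -> `|L p| <= 1 + B p.
Proof.
move=> stL.
have pos q : 0 <= L (1 * (q * s q)) by rewrite mul1r; exact: state_pos stL q.
have := state_cauchy_schwarz stL p (rmorph1 _) pos.
rewrite (state1 stL) !mul1r => cs.
have := state_bnd stL p 1; rewrite rmorph1 !mul1r (state1 stL) mulr1 => bd.
have : `|L p| ^+ 2 <= B p by rewrite real_normK ?num_real //; exact: le_trans bd.
(* Any real x satisfies x <= 1 + x ^ 2, as (x - 1 / 2) ^ 2 >= 0. *)
by have := sqr_ge0 (`|L p| - 2^-1); rewrite expr2; nra.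
Qed.

(** All the conditions on a state are closed conditions on finitely many of its
    values.  To treat them uniformly, each is written on a finite linear combination
    of values. *)
Lemma state_compact Z :
  compact [set L : prod_topology (fun _ : AA => R) | state Z L].
Proof.
pose cube : set (prod_topology (fun _ : AA => R)) :=
  [set L | forall p, `[- (1 + B p), 1 + B p] (L p)].
have ccube : compact cube.
  apply: (@tychonoff AA (fun=> R) (fun p => `[- (1 + B p), 1 + B p])) => p.
  exact: segment_compact.
have ev p : continuous (fun L : prod_topology (fun _ : AA => R) => L p : R).
  exact: (@proj_continuous AA (fun=> R) p).
pose lc (r : seq (R * AA)) (L : prod_topology (fun _ : AA => R)) : R :=
  \sum_(x <- r) x.1 * L x.2.
have lcC r : continuous (lc r).
  have add (e : R -> R -> R) (f g : prod_topology (fun _ : AA => R) -> R) :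
      continuous (fun x : R * R => e x.1 x.2) -> continuous f -> continuous g ->
      continuous (fun L => e (f L) (g L)).
    move=> ec fc gc L.
    by apply: (@cvg_comp2 _ R R R _ _ _ _ _ _ _ f g e (fc L) (gc L)); exact: (ec (f L, g L)).
  have cC (a : R) : continuous (fun _ : prod_topology (fun _ : AA => R) => a).
    exact: cst_continuous.
  elim: r => [|x r IH].
    have -> : lc [::] = (fun=> 0) by apply: funext => ?; rewrite /lc big_nil.
    exact: cC.
  have -> : lc (x :: r) = (fun L => x.1 * (L x.2 : R) + lc r L).
    by apply: funext => ?; rewrite /lc big_cons.
  apply: (add (fun a b => a + b)); [exact: add_continuous | | exact: IH].
  by apply: (add (fun a b => a * b)); [exact: mul_continuous | exact: cC | exact: ev].
have lc0 r c : closed [set L | lc r L = c].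
  apply: (@preimage_closed _ _ (lc r) [set x | x = c]); last exact: closed_eq.
  by move=> ? _; exact: lcC.
have lcge r : closed [set L | 0 <= lc r L].
  apply: (@preimage_closed _ _ (lc r) [set x | 0 <= x]); last exact: closed_ge.
  by move=> ? _; exact: lcC.
pose F (c : AA * AA * AA * R) : set (prod_topology (fun _ : AA => R)) :=
  let: (p, q, g, r) := c in
  [set L | lc [:: (1, iota r * p + q); (- r, p); (-1, q)] L = 0] `&`
  [set L | lc [:: (1, 1)] L = 1] `&`
  [set L | lc [:: (1, s p); (-1, p)] L = 0] `&`
  [set L | 0 <= lc [:: (1, p * s p)] L] `&`
  [set L | 0 <= lc [:: (B p, q * s q); (-1, q * s q * (p * s p))] L] `&`
  [set L | Z g -> lc [:: (1, g * p)] L = 0].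
have FC c : closed (F c).
  case: c => [[[p q] g] r]; do !apply: closedI => //.
  have [Zg|nZg] := EM (Z g).
    suff -> : [set L | Z g -> lc [:: (1, g * p)] L = 0] =
              [set L | lc [:: (1, g * p)] L = 0] by exact: lc0.
    by apply/seteqP; split=> L /= LL; [exact: LL | move=> _].
  suff -> : [set L | Z g -> lc [:: (1, g * p)] L = 0] = setT by exact: closedT.
  by apply/seteqP; split=> // L _ /= /nZg.
apply: (@subclosed_compact _ _ cube) => //; last first.
  by move=> L stL p; rewrite /= in_itv /= -ler_norml; exact: state_le stL.
suff -> : [set L : prod_topology (fun _ : AA => R) | state Z L] =
          \bigcap_(c in setT) F c by apply: closed_bigI => c _.
rewrite /F /lc; apply/seteqP; split => [L stL [[[p q] g] r] _|L FL].
  rewrite /= !big_cons !big_nil /= !addr0 !mul1r.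
  rewrite (state_lin stL) (state1 stL) (state_herm stL).
  do !split=> //.
  - by ring.
  - by ring.
  - exact: (state_pos stL).
  - by rewrite mulN1r subr_ge0; exact: (state_bnd stL).
  - exact: (state_null stL).
have {}FL p q g r := FL (p, q, g, r) I.
split=> [r p q||p|p|p q|g p Zg].
- have [[[[[+ _] _] _] _] _] := FL p q 0 r.
  rewrite /= !big_cons big_nil /= => e; apply/eqP; rewrite -subr_eq0 -e.
  by apply/eqP; ring.
- have [[[[[_ +] _] _] _] _] := FL 0 0 0 0.
  by rewrite /= big_seq1 mul1r.
- have [[[[[_ _] +] _] _] _] := FL p 0 0 0.
  rewrite /= !big_cons big_nil /= => e; apply/eqP; rewrite -subr_eq0 -e.
  by apply/eqP; ring.
- have [[[[[_ _] _] +] _] _] := FL p 0 0 0.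
  by rewrite /= big_seq1 mul1r.
- have [[[[[_ _] _] _] +] _] := FL p q 0 0.
  by rewrite /= !big_cons big_nil /= addr0 mulN1r subr_ge0.
- have [[[[[_ _] _] _] _] +] := FL p 0 g 0.
  by rewrite /= big_seq1 mul1r; apply.
Qed.

Lemma state_peak Z L0 h : s h = h -> state Z L0 ->
  exists2 c, L0 h <= c & exists L, state (fun g => Z g \/ g = h - iota c) L.
Proof.
move=> hh stL0.
have ne : [set L : prod_topology (fun _ : AA => R) | state Z L] !=set0.
  by exists L0.
have ev : continuous (fun L : prod_topology (fun _ : AA => R) => L h : R).
  exact: (@proj_continuous AA (fun=> R) h).
have [L] := compact_EVT_max ne (@state_compact Z) (continuous_subspaceT ev).
rewrite inE /= => stL Lmax.
exists (L h); first by apply: Lmax; rewrite inE.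
exists L; apply: state_maximum => // L' stL'.
by apply: Lmax; rewrite inE.
Qed.

(** A relation h = c obtained for one element is kept in the set of relations when
    the next element is maximized. *)
Lemma state_peaks Z L0 (hs : seq AA) : (forall h, h \in hs -> s h = h) ->
  state Z L0 -> exists (c : AA -> R) L,
    state (fun g => Z g \/ exists2 h, h \in hs & g = h - iota (c h)) L.
Proof.
elim: hs Z L0 => [|h hs IH] Z L0 hh stL0.
  by exists (fun=> 0), L0; case: stL0 => *; split=> // g p [Zg|[]//]; auto.
have [c0 _ [L1 stL1]] := state_peak (hh h (mem_head _ _)) stL0.
have [h' h'in|c [L stL]] := IH _ _ _ stL1.
  by apply: hh; rewrite inE h'in orbT.
exists (fun x => if x == h then c0 else c x), L.
case: stL => l1 l2 l3 l4 l5 l6; split=> // g p [Zg|[h' + ->]].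
  by apply: l6; left; left.
rewrite inE; case: eqP => [-> _|_ /= h'in]; apply: l6; first by left; right.
by right; exists h'.
Qed.

End States.

(** * Orthogonal projection onto a space of functions *)

Section Representer.
Context {C : numClosedFieldType} {W : eqType}.
Implicit Types (f g : W -> C) (ws : seq W).

Definition dot ws f g : C := \sum_(x <- ws) f x * (g x)^*.

Lemma dotC ws f g : dot ws g f = (dot ws f g)^*.
Proof.
by rewrite /dot rmorph_sum /=; apply: eq_bigr => x _; rewrite rmorphM /= conjCK mulrC.
Qed.

Lemma dotDl ws c f f' g :
  dot ws (fun x => c * f x + f' x) g = c * dot ws f g + dot ws f' g.
Proof.
rewrite /dot mulr_sumr -big_split /=; apply: eq_bigr => x _.
by rewrite mulrDl mulrA.
Qed.

Lemma dotDr ws c f g g' :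
  dot ws f (fun x => c * g x + g' x) = c^* * dot ws f g + dot ws f g'.
Proof. by rewrite dotC dotDl rmorphD rmorphM /= -!dotC. Qed.

Lemma dot_ge0 ws f : 0 <= dot ws f f.
Proof. by apply: sumr_ge0 => x _; rewrite mul_conjC_ge0. Qed.

Lemma dot_eq0 ws f : dot ws f f = 0 -> {in ws, forall x, f x = 0}.
Proof.
move=> /eqP; rewrite psumr_eq0 => [/allP f0 x /f0|x _]; last exact: mul_conjC_ge0.
by rewrite /= mul_conjC_eq0 => /eqP.
Qed.

Lemma dot_sumr ws (I : Type) (r : seq I) f (c : I -> C) (g : I -> W -> C) :
  dot ws f (fun x => \sum_(i <- r) c i * g i x) =
  \sum_(i <- r) (c i)^* * dot ws f (g i).
Proof.
rewrite /dot; under eq_bigr do rewrite rmorph_sum mulr_sumr.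
rewrite exchange_big; apply: eq_bigr => i _; rewrite mulr_sumr.
by apply: eq_bigr => x _; rewrite rmorphM mulrCA.
Qed.

Definition subspace (V : (W -> C) -> Prop) :=
  V (fun=> 0) /\ forall c f g, V f -> V g -> V (fun x => c * f x + g x).

Lemma subspace_sum (V : (W -> C) -> Prop) (I : Type) (r : seq I)
  (c : I -> C) (g : I -> W -> C) : subspace V -> (forall i, V (g i)) ->
  V (fun x => \sum_(i <- r) c i * g i x).
Proof.
move=> [V0 VD] Vg; elim: r => [|i r IH].
  by rewrite (_ : (fun _ => _) = fun=> 0) //; apply: funext => x; rewrite big_nil.
rewrite (_ : (fun _ => _) =
    fun x => c i * g i x + \sum_(i <- r) c i * g i x); first exact: VD.
by apply: funext => x; rewrite big_cons.
Qed.

(** The function r w represents evaluation at w on V, so it is the orthogonal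
    projection of the indicator of w.  For the induction, split off a first point
    w0: either V vanishes there, or V is the sum of its subspace V' vanishing at w0
    and of a line orthogonal to V'. *)
Lemma representer ws (V : (W -> C) -> Prop) : subspace V ->
  exists r : W -> W -> C, (forall w, V (r w)) /\
    {in ws, forall w f, V f -> dot ws f (r w) = f w}.
Proof.
elim: ws V => [|w0 ws IH] V sV.
  by exists (fun _ _ => 0); split => // w; case: sV.
have [V0 VD] := sV.
pose V' f := V f /\ f w0 = 0.
have sV' : subspace V'.
  split=> [//|c f g [Vf f0] [Vg g0]].
  by split; [exact: VD | rewrite f0 g0 mulr0 addr0].
have [r [Vr rE]] := IH V' sV'.
pose r' w := if w == w0 then fun=> 0 else r w.
have Vr' w : V' (r' w) by rewrite /r'; case: eqP.
have r'E w f : w \in w0 :: ws -> V' f -> dot (w0 :: ws) f (r' w) = f w.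
  move=> win Vf; rewrite /dot big_cons /r'; have [->|ww0] := eqVneq w w0.
    by rewrite Vf.2 mul0r add0r big1 // => x _; rewrite conjC0 mulr0.
  rewrite Vf.2 mul0r add0r; apply: rE => //.
  by move: win; rewrite inE (negbTE ww0).
have [VV'|] := EM (forall f, V f -> f w0 = 0).
  exists r'; split=> [w|w win f Vf]; first exact: (Vr' w).1.
  by apply: r'E => //; split=> //; exact: VV'.
move=> /existsNP[a /not_implyP[Va /eqP a0]].
(* P is the projection of a on V', so that b = a - P spans the orthogonal line. *)
pose P x := \sum_(w <- w0 :: ws) a w * r' w x.
have VP : V' P by apply: subspace_sum.
pose b x := - 1 * P x + a x.
have Vb : V b by apply: VD => //; case: VP.
have b0 : b w0 != 0 by rewrite /b VP.2 mulr0 add0r.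
have bV' f : V' f -> dot (w0 :: ws) f b = 0.
  move=> Vf; rewrite dotDr dot_sumr (eq_big_seq (fun w => (a w)^* * f w)).
    rewrite rmorphN1 mulN1r; apply/eqP; rewrite addrC subr_eq0; apply/eqP.
    by apply: eq_bigr => x _; rewrite mulrC.
  by move=> w win; rewrite r'E.
clearbody b.
set N := dot (w0 :: ws) b b.
have N0 : N != 0.
  by apply: contraNneq b0 => /dot_eq0 ->; rewrite ?mem_head.
exists (fun w x => (b w / N)^* * b x + r' w x); split=> [w|w win f Vf].
  by apply: VD => //; case: (Vr' w).
pose l := f w0 / b w0.
pose f' x := (- l) * b x + f x.
have Vf' : V' f'.
  split; first exact: VD.
  by rewrite /f' /l mulNr divfK // addNr.
have fE : f = fun x => l * b x + f' x.
  by apply: funext => x; rewrite /f' mulNr addNKr.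
clearbody f' l; rewrite fE dotDl !dotDr (bV' f') // (r'E w f') // mulr0 add0r.
rewrite conjCK -/N divfK // [dot _ b (r' w)]dotC (bV' (r' w)) //.
by rewrite conjC0 addr0.
Qed.

End Representer.

(** * Words and coefficients of mixed tensors *)

Section Words.
Context {n : nat}.
Implicit Types (u v y : seq 'I_n) (w : biword n).

Fixpoint words (k : nat) : seq (seq 'I_n) :=
  if k is k'.+1 then [seq a :: y | a <- enum 'I_n, y <- words k'] else [:: [::]].

Definition shape w : nat * nat := (size w.1, size w.2).

Definition bwords (s : nat * nat) : seq (biword n) :=
  [seq (u, v) | u <- words s.1, v <- words s.2].

Lemma mem_words k u : (u \in words k) = (size u == k).
Proof.
elim: k u => [|k IH] u; first by rewrite inE size_eq0.
apply/allpairsP/idP => [[[a y] /= [_ + ->]]|]; first by rewrite IH.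
case: u => // a y; rewrite eqSS => ky; exists (a, y).
by rewrite mem_enum IH.
Qed.

Lemma uniq_words k : uniq (words k).
Proof.
elim: k => // k IH; apply: allpairs_uniq => //; first exact: enum_uniq.
by move=> [a y] [b z] /= _ _ [-> ->].
Qed.

Lemma mem_bwords s w : (w \in bwords s) = (shape w == s).
Proof.
case: s w => [k l] [u v]; rewrite xpair_eqE /=.
apply/allpairsP/andP => [[[a y] /= [+ + [-> ->]]]|[ku lv]].
  by rewrite !mem_words.
by exists (u, v); rewrite !mem_words.
Qed.

Lemma uniq_bwords s : uniq (bwords s).
Proof.
by apply: allpairs_uniq => [||[? ?] [? ?]//]; exact: uniq_words.
Qed.

Definition insert_at i (a : 'I_n) u := take i u ++ a :: drop i u.

Lemma size_insert_at i a u : size (insert_at i a u) = (size u).+1.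
Proof. by rewrite size_cat /= addnS -size_cat cat_take_drop. Qed.

Lemma onth_insert_at i a u : (i <= size u)%N -> onth (insert_at i a u) i = Some a.
Proof.
move=> iu; rewrite onthE (nth_map a) ?size_insert_at //.
by rewrite nth_cat size_take_min (minn_idPl iu) ltnn subnn.
Qed.

Lemma delete_insert_at i a u : (i <= size u)%N -> delete i (insert_at i a u) = u.
Proof.
move=> iu; have si : size (take i u) = i by rewrite size_take_min (minn_idPl iu).
rewrite /delete /insert_at take_cat si ltnn subnn take0 cats0.
by rewrite drop_cat si ltnNge leqnSn /= subSnn /= drop0 cat_take_drop.
Qed.

Lemma insert_at_cat i a u v : size u = i -> insert_at i a (u ++ v) = u ++ a :: v.
Proof. by move=> <-; rewrite /insert_at take_size_cat // drop_size_cat. Qed.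

Section Sums.
Context {V : nmodType}.

Lemma big_words0 (F : seq 'I_n -> V) : \sum_(y <- words 0) F y = F [::].
Proof. exact: big_seq1. Qed.

Lemma big_wordsS k (F : seq 'I_n -> V) :
  \sum_(y <- words k.+1) F y = \sum_a \sum_(y <- words k) F (a :: y).
Proof. by rewrite big_allpairs_dep big_enum. Qed.

Lemma big_words_cat k l (F : seq 'I_n -> V) :
  \sum_(y <- words (k + l)) F y =
  \sum_(y <- words k) \sum_(z <- words l) F (y ++ z).
Proof.
elim: k F => [|k IH] F; first by rewrite big_words0.
by rewrite addSn !big_wordsS; apply: eq_bigr => a _; rewrite IH.
Qed.

Lemma big_words_rev k (F : seq 'I_n -> V) :
  \sum_(y <- words k) F (rev y) = \sum_(y <- words k) F y.
Proof.
rewrite -[LHS](big_map rev xpredT); apply: perm_big; apply: uniq_perm.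
- by rewrite map_inj_uniq ?uniq_words //; exact: can_inj revK.
- exact: uniq_words.
by move=> y; rewrite -[y in LHS]revK mem_map ?mem_words ?size_rev //; exact: can_inj revK.
Qed.

Lemma big_words_insert_at i k (F : seq 'I_n -> V) : (i <= k)%N ->
  \sum_(y <- words k.+1) F y = \sum_a \sum_(y <- words k) F (insert_at i a y).
Proof.
move=> ik; rewrite -{1}(subnKC ik) -addnS big_words_cat.
under eq_bigr do rewrite big_wordsS.
rewrite exchange_big; apply: eq_bigr => a _.
rewrite -{2}(subnKC ik) big_words_cat; apply: eq_big_seq => y.
rewrite mem_words => /eqP yi; apply: eq_bigr => z _.
by rewrite insert_at_cat.
Qed.

Lemma big_bwords s (F : biword n -> V) : \sum_(w <- bwords s) F w =
  \sum_(u <- words s.1) \sum_(v <- words s.2) F (u, v).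
Proof. exact: big_allpairs. Qed.

End Sums.

Lemma big_pick (R : nzSemiRingType) (I : eqType) (r : seq I) (j : I) (F : I -> R) :
  uniq r -> j \in r -> \sum_(i <- r) F i * (i == j)%:R = F j.
Proof.
move=> ur jr; rewrite (bigD1_seq j) //= eqxx mulr1 big1 ?addr0 // => i /negbTE ->.
by rewrite mulr0.
Qed.

Lemma bimul_inj w w' (v v' : biword n) : shape w = shape v ->
  (bimul w w' == bimul v v') = (w == v) && (w' == v').
Proof.
case: w w' v v' => [a b] [a' b'] [c d] [c' d'] [ac bd].
by rewrite /bimul !xpair_eqE /= !eqseq_cat // andbACA.
Qed.

End Words.

Section Coefficients.
Context {C : numClosedFieldType} {n : nat}.
Local Notation T := (mtensor C n).
Implicit Types (x y z : T) (w v : biword n) (U : 'M[C]_n).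

Lemma mcoeff_btensor w v : (btensor w : T)@_v = (w == v)%:R.
Proof. by rewrite mcoeffU1. Qed.

Lemma bihomP k l z :
  (forall w, shape w != (k, l) -> z@_w = 0) <-> bihom k l z.
Proof.
split=> [z0 w wz|zkl w wkl].
  have : shape w == (k, l).
    by move: wz; rewrite -mcoeff_neq0; apply: contraNT => /z0 ->.
  by rewrite xpair_eqE => /andP[/eqP -> /eqP ->].
by rewrite (bihomE w zkl); move: wkl; rewrite xpair_eqE; case: ifP.
Qed.

Lemma bihom0 k l : bihom k l (0 : T).
Proof. by apply/bihomP => w _; rewrite mcoeff0. Qed.

Lemma bihom_lin k l c x y : bihom k l x -> bihom k l y -> bihom k l (c *: x + y).
Proof.
move=> /bihomP hx /bihomP hy; apply/bihomP => w wkl.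
by rewrite mcoeffD mcoeffZ hx // hy // mulr0 addr0.
Qed.

Lemma bihom_btensor w : bihom (shape w).1 (shape w).2 (btensor w : T).
Proof.
apply/bihomP => v; rewrite mcoeff_btensor; case: (w =P v) => // ->.
by rewrite -surjective_pairing eqxx.
Qed.

Lemma bihom_sumE k l z : bihom k l z ->
  z = \sum_(w <- bwords (k, l)) z@_w *: btensor w.
Proof.
move=> /bihomP hz; apply/malgP => v; rewrite raddf_sum /=.
under eq_bigr do rewrite mcoeffZ mcoeff_btensor.
have [vs|vs] := boolP (v \in bwords (k, l)).
  by rewrite big_pick ?uniq_bwords.
rewrite hz; last by rewrite -mem_bwords.
rewrite big_seq big1 // => w ws; case: eqP => [wv|]; last by rewrite mulr0.
by rewrite -wv ws in vs.
Qed.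

Lemma mcoeffM_bimul k l x y w w' : bihom k l x -> shape w = (k, l) ->
  (x * y)@_(bimul w w') = x@_w * y@_w'.
Proof.
move=> hx ws; rewrite {1}(bihom_sumE hx) mulr_suml raddf_sum /=.
have -> : x@_w * y@_w' = \sum_(v <- bwords (k, l)) (x@_v * y@_w') * (v == w)%:R.
  by rewrite big_pick ?uniq_bwords // mem_bwords ws.
apply: eq_big_seq => v; rewrite mem_bwords => /eqP vs.
rewrite -scalerAl mcoeffZ -mulrA; congr (_ * _).
rewrite {1}[y]mtensorE mulr_sumr raddf_sum /=.
have [wy|wy] := boolP (w' \in msupp y); last first.
  rewrite (mcoeff_outdom wy) mul0r big_seq big1 // => u uy.
  rewrite scaler_mtensorAr btensorM mcoeffZ mcoeff_btensor bimul_inj ?vs ?ws //.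
  case: (u =P w') => [uw|]; last by rewrite andbF mulr0.
  by rewrite -uw uy in wy.
rewrite (eq_bigr (fun u => (y@_u * (v == w)%:R) * (u == w')%:R)).
  by rewrite (big_pick (fun u => y@_u * (v == w)%:R)) // fset_uniq.
move=> u _; rewrite scaler_mtensorAr btensorM mcoeffZ mcoeff_btensor.
by rewrite bimul_inj ?vs ?ws // -mulrA -natrM mulnb.
Qed.

Lemma bihomM k l k' l' x y : bihom k l x -> bihom k' l' y ->
  bihom (k + k') (l + l') (x * y).
Proof.
move=> hx hy; apply/bihomP => v vs.
rewrite mulr_expand raddf_sum big_seq big1 //= => w /hx [w1 w2].
rewrite raddf_sum big_seq big1 //= => w' /hy [w1' w2'].
rewrite mcoeffZ mcoeff_btensor; case: eqP => [wv|]; last by rewrite mulr0.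
by rewrite -wv /shape /= !size_cat w1 w2 w1' w2' eqxx in vs.
Qed.

Lemma contractZ i j c z : contract i j (c *: z) = c *: contract i j z.
Proof.
rewrite /contract (mmapEw (msuppZ_le _ _)) mmapE scaler_sumr.
apply: eq_bigr => w _.
by rewrite mcoeffZ /= mpolyCM -mulrA; exact: mul_malgC.
Qed.

Lemma contract_sum i j I (r : seq I) (F : I -> T) :
  contract i j (\sum_(a <- r) F a) = \sum_(a <- r) contract i j (F a).
Proof. exact: raddf_sum. Qed.

Lemma contract_expand i j k l z : (i <= k)%N -> (j <= l)%N -> bihom k.+1 l.+1 z ->
  contract i j z = \sum_(w <- bwords (k, l))
    (\sum_a z@_(insert_at i a w.1, insert_at j a w.2)) *: btensor w.
Proof.
move=> ik jl hz; rewrite {1}(bihom_sumE hz) contract_sum big_bwords big_bwords /=.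
rewrite (big_words_insert_at _ ik).
under [LHS]eq_bigr do under eq_bigr do rewrite (big_words_insert_at _ jl).
rewrite exchange_big; apply: eq_big_seq => u.
rewrite mem_words => /eqP su /=; under eq_bigr do rewrite exchange_big.
rewrite exchange_big; apply: eq_big_seq => v.
rewrite mem_words => /eqP sv /=.
rewrite scaler_suml; apply: eq_bigr => a _.
rewrite (bigD1 a) //= [X in _ + X]big1 ?addr0 => [|b ba].
  rewrite contractZ contract_btensor !onth_insert_at ?su ?sv //.
  by rewrite eqxx !delete_insert_at ?su ?sv.
rewrite contractZ contract_btensor !onth_insert_at ?su ?sv //.
case: (Some _ =P Some _) => [ab|]; last by rewrite scaler0.
by case: ab ba => ->; rewrite eqxx.
Qed.

(** Contracting sums over the letters that can be inserted at the two contracted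
    places.  In this form contractions of arbitrary homogeneous tensors can be
    compared by their coefficients. *)
Lemma contractE i j k l z w : (i <= k)%N -> (j <= l)%N -> bihom k.+1 l.+1 z ->
  shape w = (k, l) ->
  (contract i j z)@_w = \sum_a z@_(insert_at i a w.1, insert_at j a w.2).
Proof.
move=> ik jl hz ws; rewrite (contract_expand ik jl hz) raddf_sum /=.
under eq_bigr do rewrite mcoeffZ mcoeff_btensor.
by rewrite (big_pick (fun w : biword n => \sum_a z@_(insert_at i a w.1, insert_at j a w.2)))
     ?uniq_bwords // mem_bwords ws.
Qed.

Lemma bihom_contract i j k l z : (i <= k)%N -> (j <= l)%N -> bihom k.+1 l.+1 z ->
  bihom k l (contract i j z).
Proof.
move=> ik jl hz; rewrite (contract_expand ik jl hz).
rewrite big_seq; apply: big_ind; first exact: bihom0.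
  by move=> x y hx hy; rewrite -[x]scale1r; exact: bihom_lin.
move=> w; rewrite mem_bwords => /eqP ws.
rewrite -[X in bihom _ _ X]addr0; apply: bihom_lin; last exact: bihom0.
by have := @bihom_btensor w; rewrite ws.
Qed.

Lemma idtensorE : idtensor = \sum_i btensor ([:: i], [:: i]) :> T.
Proof. by apply: eq_bigr => i _; rewrite vec_std covec_std btensorM. Qed.

Lemma bihom_idtensor : bihom 1 1 (idtensor : T).
Proof.
apply/bihomP => w ws; rewrite idtensorE raddf_sum big1 //= => i _.
by move: ws; rewrite mcoeff_btensor; case: (_ =P w) => // <-; rewrite eqxx.
Qed.

Lemma mcoeff_idtensor a b : (idtensor : T)@_([:: a], [:: b]) = (a == b)%:R.
Proof.
rewrite idtensorE raddf_sum /= (bigD1 a) //= big1 ?addr0 => [|i ia].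
  by rewrite mcoeff_btensor; congr (_ %:R); congr nat_of_bool; apply/eqP/eqP => [[->]|->].
by move: ia; rewrite mcoeff_btensor; case: (_ =P ([:: a], _)) => // -[->]; rewrite eqxx.
Qed.

End Coefficients.

(** * The action of matrices in coordinates *)

Section Action.
Context {C : numClosedFieldType} {n : nat}.
Local Notation T := (mtensor C n).
Implicit Types (x y z : T) (w v : biword n) (U : 'M[C]_n).
Local Open Scope sesquilinear_scope.

Definition entry_prod U (u v : seq 'I_n) : C := \prod_(p <- zip u v) U p.1 p.2.

Lemma entry_prod_cons U a b (u v : seq 'I_n) :
  entry_prod U (a :: u) (b :: v) = U a b * entry_prod U u v.
Proof. by rewrite /entry_prod big_cons. Qed.

Lemma entry_prod_cat U (u u' v v' : seq 'I_n) : size u = size v ->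
  entry_prod U (u ++ u') (v ++ v') = entry_prod U u v * entry_prod U u' v'.
Proof. by move=> uv; rewrite /entry_prod zip_cat // big_cat. Qed.

Lemma entry_prod_insert_at U i a b (u v : seq 'I_n) : size u = size v ->
  entry_prod U (insert_at i a u) (insert_at i b v) = U a b * entry_prod U u v.
Proof.
move=> uv; rewrite /insert_at -{3}(cat_take_drop i u) -{3}(cat_take_drop i v).
by rewrite !entry_prod_cat ?entry_prod_cons 1?mulrCA // !size_take_min uv.
Qed.

(** The reordering of sums needed to compare the two sides of [act_contract]. *)
Lemma big_rot5 (V : nmodType) (I : finType) (J : Type) (r r' : seq J)
    (F : I -> I -> J -> I -> J -> V) :
  \sum_a \sum_b \sum_(u <- r) \sum_c \sum_(y <- r') F a b u c y =
  \sum_(u <- r) \sum_(y <- r') \sum_b \sum_c \sum_a F a b u c y.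
Proof.
under eq_bigr do rewrite exchange_big.
rewrite exchange_big; apply: eq_bigr => u _.
under eq_bigr do under eq_bigr do rewrite exchange_big.
under eq_bigr do rewrite exchange_big.
rewrite exchange_big; apply: eq_bigr => y _.
by rewrite exchange_big; apply: eq_bigr => b _; rewrite exchange_big.
Qed.

(** The coefficient of [btensor v] in the image of [btensor w]. *)
Definition act_coef U v w : C :=
  if shape w == shape v then entry_prod U v.1 w.1 * entry_prod (invmx U^T) v.2 w.2 else 0.

Lemma mcoeff_prod_vec U (s : seq 'I_n) :
  bihom (size s) 0 (\prod_(i <- s) vec (U *m std i) : T) /\
  forall u, size u = size s ->
    (\prod_(i <- s) vec (U *m std i) : T)@_(u, [::]) = entry_prod U u s.
Proof.
have bv (x : 'cV[C]_n) : bihom 1 0 (vec x : T).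
  apply/bihomP => w ws; rewrite raddf_sum big1 //= => i _.
  rewrite mcoeffZ mcoeff_btensor; move: ws.
  by case: (_ =P w) => [<-|]; rewrite ?eqxx // mulr0.
have vE (x : 'cV[C]_n) a : (vec x : T)@_([:: a], [::]) = x a ord0.
  rewrite raddf_sum -[RHS](@big_pick _ _ (index_enum 'I_n) _ (fun i => x i ord0)).
  - apply: eq_bigr => i _; rewrite /= mcoeffZ mcoeff_btensor; congr (_ * _%:R).
    by congr nat_of_bool; apply/eqP/eqP => [[]|->].
  - exact: index_enum_uniq.
  - exact: mem_index_enum.
elim: s => [|i s [IH1 IH2]].
  rewrite big_nil; split=> [|[]// _]; first exact: (@bihom_btensor C n (bione n)).
  by rewrite -btensor1 mcoeff_btensor eqxx /entry_prod big_nil.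
rewrite big_cons; split=> [|[//|a u] [us]]; first exact: bihomM (bv _) IH1.
rewrite -[(a :: u, [::])]/(bimul ([:: a], [::]) (u, [::])).
by rewrite (mcoeffM_bimul _ _ (bv _)) // vE mulmx_std IH2 // entry_prod_cons.
Qed.

Lemma mcoeff_prod_covec U (s : seq 'I_n) :
  bihom 0 (size s) (\prod_(i <- s) covec (U *m std i) : T) /\
  forall u, size u = size s ->
    (\prod_(i <- s) covec (U *m std i) : T)@_([::], u) = entry_prod U u s.
Proof.
have bv (x : 'cV[C]_n) : bihom 0 1 (covec x : T).
  apply/bihomP => w ws; rewrite raddf_sum big1 //= => i _.
  rewrite mcoeffZ mcoeff_btensor; move: ws.
  by case: (_ =P w) => [<-|]; rewrite ?eqxx // mulr0.
have vE (x : 'cV[C]_n) a : (covec x : T)@_([::], [:: a]) = x a ord0.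
  rewrite raddf_sum -[RHS](@big_pick _ _ (index_enum 'I_n) _ (fun i => x i ord0)).
  - apply: eq_bigr => i _; rewrite /= mcoeffZ mcoeff_btensor; congr (_ * _%:R).
    by congr nat_of_bool; apply/eqP/eqP => [[]|->].
  - exact: index_enum_uniq.
  - exact: mem_index_enum.
elim: s => [|i s [IH1 IH2]].
  rewrite big_nil; split=> [|[]// _]; first exact: (@bihom_btensor C n (bione n)).
  by rewrite -btensor1 mcoeff_btensor eqxx /entry_prod big_nil.
rewrite big_cons; split=> [|[//|a u] [us]]; first exact: bihomM (bv _) IH1.
rewrite -[([::], a :: u)]/(bimul ([::], [:: a]) ([::], u)).
by rewrite (mcoeffM_bimul _ _ (bv _)) // vE mulmx_std IH2 // entry_prod_cons.
Qed.

Lemma mcoeff_actw U v w : (actw U w : T)@_v = act_coef U v w.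
Proof.
have [b1 e1] := mcoeff_prod_vec U w.1.
have [b2 e2] := mcoeff_prod_covec (invmx U^T) w.2.
rewrite /actw /act_coef; case: ifP => [|wv].
  rewrite xpair_eqE => /andP[/eqP w1 /eqP w2].
  have {1}-> : v = bimul (v.1, [::]) ([::], v.2).
    by rewrite /bimul /= cats0; case: (v).
  by rewrite (mcoeffM_bimul _ _ b1) ?e1 ?e2 // /shape w1.
have /bihomP := bihomM b1 b2; apply.
by rewrite addn0 add0n eq_sym; exact/negbT.
Qed.

Lemma mcoeff_act U z v :
  (act U z)@_v = \sum_(w <- bwords (shape v)) z@_w * act_coef U v w.
Proof.
rewrite /act mmapE raddf_sum /=.
under eq_bigr do rewrite mul_malgC mcoeffZ mcoeff_actw.
transitivity (\sum_(w <- bwords (shape v))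
    (\sum_(u <- msupp z) (z@_u * act_coef U v u) * (u == w)%:R)).
  rewrite exchange_big; apply: eq_bigr => u _ /=.
  have [us|us] := boolP (u \in bwords (shape v)).
    under eq_bigr do rewrite eq_sym.
    by rewrite (big_pick (fun=> z@_u * act_coef U v u)) ?uniq_bwords.
  rewrite /act_coef -mem_bwords (negbTE us) mulr0 big1 // => w _.
  by rewrite mul0r.
apply: eq_bigr => w _; have [wz|wz] := boolP (w \in msupp z).
  by rewrite (big_pick (fun u => z@_u * act_coef U v u)) ?fset_uniq.
rewrite (mcoeff_outdom wz) mul0r big_seq big1 // => u uz.
by case: eqP => [uw|]; rewrite ?mulr0 // uw (negbTE wz) in uz *.
Qed.

Lemma act_hcomp U k l z : act U (hcomp k l z) = hcomp k l (act U z).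
Proof.
apply/malgP => v; rewrite [LHS]mcoeff_act [RHS]hcompE mcoeff_act; case: ifP => vs.
  apply: eq_big_seq => w; rewrite mem_bwords => /eqP[w1 w2].
  by rewrite hcompE w1 w2 vs.
rewrite big_seq big1 // => w; rewrite mem_bwords => /eqP[w1 w2].
by rewrite hcompE w1 w2 vs mul0r.
Qed.

(** The sum over the letter inserted at both contracted places pairs a column of U
    with a column of its inverse transpose, which gives a Kronecker symbol. *)
Lemma act_contract U i j k l z : U \in unitmx -> (i <= k)%N -> (j <= l)%N ->
  bihom k.+1 l.+1 z -> act U (contract i j z) = contract i j (act U z).
Proof.
move=> uU ik jl hz.
have ha : bihom k.+1 l.+1 (act U z).
  apply/bihomP => v vs; rewrite mcoeff_act big_seq big1 // => w.
  rewrite mem_bwords => /eqP ws; move/bihomP: hz => ->; first by rewrite mul0r.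
  by rewrite ws.
have hc := bihom_contract ik jl hz.
have uT : U^T \in unitmx by rewrite unitmx_tr.
apply/malgP => v; have [vs|vs] := eqVneq (shape v) (k, l); last first.
  have /bihomP -> // := bihom_contract ik jl ha.
  rewrite mcoeff_act big_seq big1 // => w; rewrite mem_bwords => /eqP ws.
  by move/bihomP: hc => ->; [rewrite mul0r | rewrite ws].
rewrite (contractE ik jl ha vs) mcoeff_act vs.
have vs1 : size v.1 = k by case: vs.
have vs2 : size v.2 = l by case: vs.
transitivity (\sum_(u <- words k) \sum_(y <- words l) \sum_b \sum_c \sum_a
   z@_(insert_at i b u, insert_at j c y) *
     (U a b * entry_prod U v.1 u *
       (invmx U^T a c * entry_prod (invmx U^T) v.2 y))).
  rewrite big_bwords; apply: eq_big_seq => u; rewrite mem_words => /eqP su.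
  apply: eq_big_seq => y; rewrite mem_words => /eqP sy /=.
  rewrite (contractE ik jl hz) /shape /= ?su ?sy // mulr_suml.
  apply: eq_bigr => b _; rewrite (bigD1 b) //= [X in _ + X]big1 ?addr0.
    rewrite /act_coef /shape /= su sy vs1 vs2 eqxx -mulr_sumr; congr (_ * _).
    rewrite (eq_bigr (fun a => (U^T b a * invmx U^T a b) *
       (entry_prod U v.1 u * entry_prod (invmx U^T) v.2 y))) => [|a _]; last first.
      by rewrite mxE mulrACA.
    rewrite -mulr_suml; have := congr1 (fun M : 'M_n => M b b) (mulmxV uT).
    by rewrite !mxE eqxx => ->; rewrite mul1r.
  move=> c cb; rewrite -mulr_sumr.
  rewrite (eq_bigr (fun a => (U^T b a * invmx U^T a c) *
       (entry_prod U v.1 u * entry_prod (invmx U^T) v.2 y))) => [|a _]; last first.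
    by rewrite mxE mulrACA.
  rewrite -mulr_suml; have := congr1 (fun M : 'M_n => M b c) (mulmxV uT).
  by rewrite !mxE eq_sym (negbTE cb) => ->; rewrite mul0r mulr0.
under [RHS]eq_bigr => a _ do rewrite mcoeff_act /shape /= !size_insert_at vs1 vs2
  big_bwords /= (big_words_insert_at _ ik).
under [RHS]eq_bigr => a _ do under eq_bigr => b _ do
  under eq_bigr => u _ do rewrite (big_words_insert_at _ jl).
rewrite [RHS]big_rot5; apply: eq_big_seq => u; rewrite mem_words => /eqP su.
apply: eq_big_seq => y; rewrite mem_words => /eqP sy.
apply: eq_bigr => b _; apply: eq_bigr => c _; apply: eq_bigr => a _.
by rewrite /act_coef /shape /= !size_insert_at su sy vs1 vs2 eqxx !entry_prod_insert_at ?su ?sy.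
Qed.

End Action.

(** * Invariants of a group form a contraction-closed graded subalgebra *)

Section InvariantsClosed.
Context {C : numClosedFieldType} {n : nat}.
Local Notation T := (mtensor C n).
Implicit Types (x y z : T) (w v : biword n) (U : 'M[C]_n).
Local Open Scope sesquilinear_scope.

Lemma star_vec (a : 'cV[C]_n) : star (vec a) = covec (map_mx Num.conj a) :> T.
Proof.
rewrite star_sum; apply: eq_bigr => i _.
by rewrite starZ star_btensor mxE.
Qed.

Lemma star_covec (a : 'cV[C]_n) : star (covec a) = vec (map_mx Num.conj a) :> T.
Proof.
rewrite star_sum; apply: eq_bigr => i _.
by rewrite starZ star_btensor mxE.
Qed.

(** The map sending z to star (act V (star z)) is multiplicative and linear, so by
    uniqueness of the action only its values on vectors and covectors matter. *)
Lemma act_star U z : U \in unitmx -> act U (star z) = star (act (invmx (U ^t*)) z).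
Proof.
move=> uU; set V := invmx (U ^t*).
suff E : forall x, star (act V (star x)) = act U x by rewrite -E starK.
have V1 : map_mx Num.conj (invmx V^T) = U.
  rewrite /V trmx_inv invmxK; apply/matrixP => i j.
  by rewrite !mxE /= conjCK.
have V2 : map_mx Num.conj V = invmx U^T.
  by rewrite /V map_invmx; congr invmx; apply/matrixP => i j; rewrite !mxE /= conjCK.
apply: act_unique.
- by move=> c x y; rewrite starD starZ actD actZ starD starZ /= conjCK.
- by move=> x y; rewrite !(starM, actM).
- by rewrite -btensor1 star_btensor btensor1 act1 -btensor1 star_btensor.
- move=> a; rewrite star_vec act_covec star_covec map_mxM V1.
  by congr (vec (_ *m _)); apply/matrixP => i j; rewrite !mxE /= conjCK.
- move=> a; rewrite star_covec act_vec star_vec map_mxM V2.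
  by congr (covec (_ *m _)); apply/matrixP => i j; rewrite !mxE /= conjCK.
Qed.

Lemma act_idtensor U : U \in unitmx -> act U idtensor = idtensor :> T.
Proof.
move=> uU; rewrite [in LHS]/idtensor act_sum.
transitivity (\sum_(i < n) \sum_(a < n) \sum_(b < n)
  (U a i * invmx U^T b i) *: btensor ([:: a], [:: b]) : T).
  apply: eq_bigr => i _; rewrite actM.
  rewrite [LHS](congr2 *%R (act_vec U (std i)) (act_covec U (std i))).
  rewrite /vec mulr_suml; apply: eq_bigr => a _.
  rewrite /covec mulr_sumr; apply: eq_bigr => b _.
  by rewrite -scalerAl scaler_mtensorAr btensorM scalerA !mulmx_std.
rewrite exchange_big idtensorE; apply: eq_bigr => a _.
rewrite exchange_big (bigD1 a) //= [X in _ + X]big1 ?addr0.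
  rewrite -scaler_suml (_ : \sum_i _ = 1) ?scale1r //.
  have := congr1 (fun M : 'M_n => M a a) (mulmxV uU).
  rewrite !mxE eqxx => E; etransitivity; last exact: E.
  apply: eq_bigr => i _.
  by rewrite -trmx_inv mxE.
move=> b ba; rewrite -scaler_suml (_ : \sum_i _ = 0) ?scale0r //.
have := congr1 (fun M : 'M_n => M a b) (mulmxV uU).
rewrite !mxE eq_sym (negbTE ba) => E; etransitivity; last exact: E.
apply: eq_bigr => i _.
by rewrite -trmx_inv mxE.
Qed.

Lemma invariants_ccg (G : set 'M[C]_n) : G `<=` GL ->
  (forall U, G U -> G (invmx (U ^t*))) ->
  is_ccg_star_subalgebra (invariants G : set T).
Proof.
move=> GU Gs; set A := invariants G.
have alg : is_subalgebra A.
  split.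
  - by apply/mem_set => U _; exact: act1.
  - move=> c x y /set_mem Ax /set_mem Ay; apply/mem_set => U GGU.
    by rewrite actD actZ Ax ?Ay.
  - move=> x y /set_mem Ax /set_mem Ay; apply/mem_set => U GGU.
    by rewrite actM Ax ?Ay.
have st z : A z -> A (star z).
  by move=> Az U GGU; rewrite act_star ?Az //; [exact: Gs | exact: GU].
split=> //.
- by apply/(gradedP alg) => k l z Az U GGU; rewrite act_hcomp Az.
- apply/seteqP; split => [z Az|_ [z Az <-]]; last exact: st.
  by exists (star z); [exact: st | exact: starK].
- move=> k l i j z [Az zh] U GGU.
  case: k i zh => [[]//|k] i; case: l j => [[]//|l] j zh.
  by rewrite (act_contract (GU _ GGU) _ _ zh) ?Az // -ltnS.
Qed.

End InvariantsClosed.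

(** * Composition and block permutation inside a contraction-closed algebra *)

Section Shapes.
Context {n : nat}.
Implicit Types (w v : biword n) (s t : nat * nat).

Definition sadd s t : nat * nat := (s.1 + t.1, s.2 + t.2)%N.
Definition sswap s : nat * nat := (s.2, s.1).

(** The word of the adjoint basis tensor.  A word of the form [bimul v (wstar w)]
    is used to index the matrix unit from w to v, so that tensors of shape
    [sadd s (sswap t)] are operators from shape t to shape s. *)
Definition wstar w : biword n := (rev w.2, rev w.1).

Lemma wstarK w : wstar (wstar w) = w.
Proof. by case: w => a b; rewrite /wstar /= !revK. Qed.

Lemma wstar_mul w v : wstar (bimul w v) = bimul (wstar v) (wstar w).
Proof. by rewrite /wstar /bimul /= !rev_cat. Qed.

Lemma shape_star w : shape (wstar w) = sswap (shape w).
Proof. by rewrite /shape /= !size_rev. Qed.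

Lemma shape_bimul w v : shape (bimul w v) = sadd (shape w) (shape v).
Proof. by rewrite /shape /= !size_cat. Qed.

Lemma saddA s t r : sadd s (sadd t r) = sadd (sadd s t) r.
Proof. by rewrite /sadd !addnA. Qed.

Lemma saddC s t : sadd s t = sadd t s.
Proof. by rewrite /sadd addnC [(s.2 + _)%N]addnC. Qed.

Lemma sswapD s t : sswap (sadd s t) = sadd (sswap t) (sswap s).
Proof. by rewrite [RHS]saddC. Qed.

Lemma sswapK s : sswap (sswap s) = s.
Proof. by case: s. Qed.

Lemma big_bwords_bimul (V : nmodType) s t (F : biword n -> V) :
  \sum_(w <- bwords (sadd s t)) F w =
  \sum_(v <- bwords s) \sum_(w <- bwords t) F (bimul v w).
Proof.
rewrite big_bwords /= big_words_cat big_bwords; apply: eq_bigr => u _ /=.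
under [LHS]eq_bigr do rewrite big_words_cat.
rewrite exchange_big; apply: eq_bigr => v _.
by rewrite big_bwords.
Qed.

Lemma big_bwords_star (V : nmodType) s (F : biword n -> V) :
  \sum_(w <- bwords (sswap s)) F w = \sum_(w <- bwords s) F (wstar w).
Proof.
rewrite !big_bwords exchange_big /= -[RHS]big_words_rev.
apply: eq_bigr => u _; rewrite -[RHS]big_words_rev; apply: eq_bigr => v _.
by rewrite /wstar /= !revK.
Qed.

End Shapes.

Section Subalgebra.
Context {C : numClosedFieldType} {n : nat}.
Local Notation T := (mtensor C n).
Context {A : set T} (ccgA : is_ccg_star_subalgebra A) (idA : A idtensor).
Implicit Types (x y z : T) (w v : biword n) (s t r : nat * nat).

Definition piece s x := A x /\ bihom s.1 s.2 x.

Lemma ccg_lin c x y : A x -> A y -> A (c *: x + y).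
Proof.
case: ccgA => -[_ AL _] _ _ _ Ax Ay; apply/set_mem.
by apply: AL; exact/mem_set.
Qed.

Lemma ccg0 : A 0.
Proof. by have := ccg_lin (-1) idA idA; rewrite scaleN1r addNr. Qed.

Lemma ccgM x y : A x -> A y -> A (x * y).
Proof.
case: ccgA => -[_ _ AM] _ _ _ Ax Ay; apply/set_mem.
by apply: AM; exact/mem_set.
Qed.

Lemma ccg_star x : A x -> A (star x).
Proof. by case: ccgA => _ _ As _ Ax; rewrite As; exists x. Qed.

Lemma piece0 s : piece s 0.
Proof. by split; [exact: ccg0 | exact: bihom0]. Qed.

Lemma piece_lin s c x y : piece s x -> piece s y -> piece s (c *: x + y).
Proof. by move=> [Ax hx] [Ay hy]; split; [exact: ccg_lin | exact: bihom_lin]. Qed.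

Lemma piece_sum s (I : Type) (r : seq I) (c : I -> C) (F : I -> T) :
  (forall i, piece s (F i)) -> piece s (\sum_(i <- r) c i *: F i).
Proof.
move=> hF; apply: big_ind => [|x y hx hy|i _]; first exact: piece0.
  by rewrite -[x]scale1r; exact: piece_lin.
by rewrite -[_ *: _]addr0; apply: piece_lin => //; exact: piece0.
Qed.

Lemma pieceM s t x y : piece s x -> piece t y -> piece (sadd s t) (x * y).
Proof. by move=> [Ax hx] [Ay hy]; split; [exact: ccgM | exact: bihomM]. Qed.

Lemma piece_star s x : piece s x -> piece (sswap s) (star x).
Proof.
move=> [Ax /bihomP hx]; split; first exact: ccg_star.
apply/bihomP => w ws; rewrite starE hx ?rmorph0 // -[(rev _, _)]/(wstar w).
apply: contra ws; rewrite -!surjective_pairing shape_star => /eqP <-.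
by rewrite sswapK.
Qed.

Lemma piece_contract i j k l x : (i <= k)%N -> (j <= l)%N ->
  piece (k.+1, l.+1) x -> piece (k, l) (contract i j x).
Proof.
move=> ik jl [Ax hx]; split; last exact: bihom_contract.
case: ccgA => _ _ _ /(_ k.+1 l.+1 (inord i) (inord j) x (conj Ax hx)).
by rewrite !inordK.
Qed.

Lemma piece_idtensor : piece (1, 1)%N idtensor.
Proof. by split; [exact: idA | exact: bihom_idtensor]. Qed.

(** Contracts k letters starting at place p of the V-part against k letters starting
    at place q of the V*-part, in opposite orders: the reversal makes the paired
    blocks be y and rev y, as in [bimul v (wstar y)] next to [bimul y u]. *)
Fixpoint contract_block p q k x :=
  if k is k'.+1 then contract_block p q k' (contract p (q + k') x) else x.

Lemma contract_blockP p q k m l x : (p <= m)%N -> (q <= l)%N ->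
  piece (k + m, k + l)%N x ->
  piece (m, l) (contract_block p q k x) /\
  forall (v1 u1 v2 u2 : seq 'I_n), size v1 = p -> size v2 = q ->
    size (v1 ++ u1) = m -> size (v2 ++ u2) = l ->
    (contract_block p q k x)@_(v1 ++ u1, v2 ++ u2) =
    \sum_(y <- words k) x@_(v1 ++ y ++ u1, v2 ++ rev y ++ u2).
Proof.
move=> pm ql; elim: k x => [|k IH] x hx.
  by split=> // v1 u1 v2 u2 _ _ _ _; rewrite big_words0.
have pk : (p <= k + m)%N by rewrite (leq_trans pm) ?leq_addl.
have qk : (q + k <= k + l)%N by rewrite addnC leq_add2l.
have [h1 h2] := IH _ (piece_contract pk qk hx).
split=> // v1 u1 v2 u2 sv1 sv2 su1 su2; rewrite /= h2 // big_wordsS exchange_big.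
apply: eq_big_seq => y; rewrite mem_words => /eqP sy.
rewrite (contractE pk qk hx.2) /=; last first.
  move: su1 su2; rewrite /shape /= !size_cat size_rev sy => <- <-.
  by rewrite !(addnCA _ k).
apply: eq_bigr => a _; rewrite insert_at_cat // catA insert_at_cat; last first.
  by rewrite size_cat size_rev sv2 sy.
by rewrite rev_cons cat_rcons -catA.
Qed.

(** Composition of operators stays in the algebra: multiply the two tensors, then
    contract the V-part of the inner word y with the V*-part of its adjoint, and the
    two other blocks likewise. *)
Lemma piece_comp s t r (b x : T) : piece (sadd s (sswap t)) b -> piece (sadd t r) x ->
  exists2 q, piece (sadd s r) q & forall v u, shape v = s -> shape u = r ->
    q@_(bimul v u) =
    \sum_(y <- bwords t) b@_(bimul v (wstar y)) * x@_(bimul y u).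
Proof.
case: s t r => [s1 s2] [t1 t2] [r1 r2] hb hx.
(* The block of length t1 is contracted first, then the block of length t2. *)
have h0 : piece (t1 + (s1 + t2 + r1), t1 + (s2 + (t2 + r2)))%N (b * x).
  have := pieceM hb hx; rewrite /sadd /=; congr (piece (_, _) _).
    by rewrite !addnA [(t1 + s1)%N]addnC; congr (_ + _)%N; rewrite addnAC.
  by rewrite !addnA [(t1 + s2)%N]addnC.
have [||h1 e1] := contract_blockP _ _ h0 (p := (s1 + t2)%N) (q := s2).
- by rewrite leq_addr.
- by rewrite leq_addr.
have h1' : piece (t2 + (s1 + r1), t2 + (s2 + r2))%N
    (contract_block (s1 + t2) s2 t1 (b * x)).
  move: h1; congr (piece (_, _) _).
    by rewrite [RHS]addnCA addnA.
  by rewrite [RHS]addnCA.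
have [||h2 e2] := contract_blockP _ _ h1' (p := s1) (q := s2).
- by rewrite leq_addr.
- by rewrite leq_addr.
exists (contract_block s1 s2 t2 (contract_block (s1 + t2) s2 t1 (b * x))) => //.
move=> [v1 v2] [u1 u2] [sv1 sv2] [su1 su2].
rewrite [LHS]e2 ?size_cat ?sv1 ?sv2 ?su1 ?su2 // -[LHS]big_words_rev.
rewrite big_bwords exchange_big; apply: eq_big_seq => y2.
rewrite mem_words => /eqP sy2; rewrite revK catA e1.
- apply: eq_big_seq => y1; rewrite mem_words => /eqP sy1.
  rewrite -(mcoeffM_bimul _ _ hb.2); last first.
    by rewrite /shape /= !size_cat !size_rev sv1 sv2 sy1 sy2.
  by rewrite /bimul /= -!catA.
- by rewrite size_cat size_rev sv1 sy2.
- by [].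
- by rewrite !size_cat size_rev sv1 sy2 su1.
- by rewrite !size_cat sv2 sy2 su2.
Qed.

(** Multiplying by the identity tensor and contracting its covector with the i-th
    vector factor moves that factor to the front. *)
Lemma piece_moveV i k l x : (i <= k)%N -> piece (k.+1, l) x ->
  exists2 y, piece (k.+1, l) y & forall j u d, size u = k -> size d = l ->
    y@_(j :: u, d) = x@_(insert_at i j u, d).
Proof.
move=> ik hx.
have h0 : piece (k.+2, l.+1) (idtensor * x) := pieceM piece_idtensor hx.
have i1 : (i.+1 <= k.+1)%N by [].
exists (contract i.+1 0 (idtensor * x)); first exact: piece_contract h0.
move=> j u d su sd; rewrite (contractE i1 (leq0n _) h0.2) /shape /= ?su ?sd //.
rewrite -[RHS](@big_pick _ _ (index_enum 'I_n) _ (fun a : 'I_n => x@_(insert_at i a u, d)));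
  [|exact: index_enum_uniq|exact: mem_index_enum].
apply: eq_bigr => a _; rewrite mulrC eq_sym -mcoeff_idtensor.
by rewrite -(mcoeffM_bimul _ _ bihom_idtensor) // /bimul /insert_at /= take0 drop0.
Qed.

Lemma piece_moveC j k l x : (j <= l)%N -> piece (k, l.+1) x ->
  exists2 y, piece (k, l.+1) y & forall i u d, size u = k -> size d = l ->
    y@_(u, i :: d) = x@_(u, insert_at j i d).
Proof.
move=> jl hx.
have h0 : piece (k.+1, l.+2) (idtensor * x) := pieceM piece_idtensor hx.
have j1 : (j.+1 <= l.+1)%N by [].
exists (contract 0 j.+1 (idtensor * x)); first exact: piece_contract h0.
move=> i u d su sd; rewrite (contractE (leq0n _) j1 h0.2) /shape /= ?su ?sd //.
rewrite -[RHS](@big_pick _ _ (index_enum 'I_n) _ (fun a : 'I_n => x@_(u, insert_at j a d)));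
  [|exact: index_enum_uniq|exact: mem_index_enum].
apply: eq_bigr => a _; rewrite mulrC -mcoeff_idtensor.
by rewrite -(mcoeffM_bimul _ _ bihom_idtensor) // /bimul /insert_at /= take0 drop0.
Qed.

(** The last letter of the second block always sits at place p + q - 1; moving the
    letter at that place to the front q times carries the whole block to the front. *)
Lemma piece_swapV p q k l x : piece (p + q + k, l)%N x ->
  exists2 y, piece (p + q + k, l)%N y & forall a b c d, size a = p -> size b = q ->
    size c = k -> size d = l -> y@_(b ++ a ++ c, d) = x@_(a ++ b ++ c, d).
Proof.
elim: q p x => [|q IH] p x hx.
  by exists x => // a [|//] c d _ _ _ _.
rewrite addnS addSn in hx *.
have [|y0 hy0 e0] := IH p.+1 x; first by rewrite !addSn.
rewrite !addSn in hy0.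
have [|y hy e] := piece_moveV (i := (q + p)%N) _ hy0.
  by rewrite addnC leq_addr.
exists y => // a [//|j b] c d sa [sb] sc sd.
rewrite /= e //; last by rewrite !size_cat sa sb sc addnA [(q + p)%N]addnC.
rewrite catA insert_at_cat; last by rewrite size_cat sa sb.
rewrite -catA -cat_rcons e0 ?size_rcons ?sa //.
by rewrite cat_rcons.
Qed.

Lemma piece_swapC p q k l x : piece (k, p + q + l)%N x ->
  exists2 y, piece (k, p + q + l)%N y & forall a b c d, size a = p -> size b = q ->
    size c = l -> size d = k -> y@_(d, b ++ a ++ c) = x@_(d, a ++ b ++ c).
Proof.
elim: q p x => [|q IH] p x hx.
  by exists x => // a [|//] c d _ _ _ _.
rewrite addnS addSn in hx *.
have [|y0 hy0 e0] := IH p.+1 x; first by rewrite !addSn.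
rewrite !addSn in hy0.
have [|y hy e] := piece_moveC (j := (q + p)%N) _ hy0.
  by rewrite addnC leq_addr.
exists y => // a [//|j b] c d sa [sb] sc sd.
rewrite /= e //; last by rewrite !size_cat sa sb sc addnA [(q + p)%N]addnC.
rewrite catA insert_at_cat; last by rewrite size_cat sa sb.
rewrite -catA -cat_rcons e0 ?size_rcons ?sa //.
by rewrite cat_rcons.
Qed.

Lemma piece_swap s t r x : piece (sadd (sadd s t) r) x ->
  exists2 y, piece (sadd (sadd s t) r) y & forall a b c,
    shape a = s -> shape b = t -> shape c = r ->
    y@_(bimul b (bimul a c)) = x@_(bimul a (bimul b c)).
Proof.
case: s t r => [s1 s2] [t1 t2] [r1 r2] hx.
have [y0 hy0 e0] := piece_swapV hx.
have [y hy e] := piece_swapC hy0.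
exists y => // -[a1 a2] [b1 b2] [c1 c2] [sa1 sa2] [sb1 sb2] [sc1 sc2].
rewrite /bimul /= e ?size_cat ?sa1 ?sb1 ?sc1 ?sa2 ?sb2 ?sc2 ?addnA //.
  by rewrite e0 // !size_cat sa2 sb2 sc2 addnA.
by rewrite [(t1 + s1)%N]addnC.
Qed.

End Subalgebra.

Arguments piece {C n} A s x.

(** * The kernel of the orthogonal projection onto the algebra *)

Section Kernel.
Context {C : numClosedFieldType} {n : nat}.
Local Notation T := (mtensor C n).
Context {A : set T} (ccgA : is_ccg_star_subalgebra A) (idA : A idtensor).
Implicit Types (x y z : T) (w v : biword n) (s t r : nat * nat).
Local Notation piece := (piece A).

Definition hdot s x y : C := dot (bwords s) (fun w => x@_w) (fun w => y@_w).

Lemma hdotC s x y : hdot s y x = (hdot s x y)^*.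
Proof. exact: dotC. Qed.

Lemma hdotDr s x c y z : hdot s x (c *: y + z) = c^* * hdot s x y + hdot s x z.
Proof.
by rewrite -dotDr; apply: eq_bigr => w _; rewrite mcoeffD mcoeffZ.
Qed.

Lemma hdot_sumr s x (I : Type) (r : seq I) (c : I -> C) (F : I -> T) :
  hdot s x (\sum_(i <- r) c i *: F i) = \sum_(i <- r) (c i)^* * hdot s x (F i).
Proof.
rewrite -dot_sumr; apply: eq_bigr => w _; rewrite raddf_sum /=.
by under eq_bigr do rewrite mcoeffZ.
Qed.

Lemma piece_out s x w : piece s x -> shape w != s -> x@_w = 0.
Proof. by move=> [_ /bihomP hx] ws; apply: hx; rewrite -surjective_pairing. Qed.

Lemma piece_eq s x y : piece s x -> piece s y ->
  (forall z, piece s z -> hdot s z x = hdot s z y) -> x = y.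
Proof.
move=> hx hy e; have hd : piece s (-1 *: y + x) by apply: piece_lin.
have d0 : hdot s (-1 *: y + x) (-1 *: y + x) = 0.
  by rewrite hdotDr rmorphN1 mulN1r (e _ hd) addNr.
apply/malgP => w; have [ws|ws] := eqVneq (shape w) s; last first.
  by rewrite !(piece_out _ ws).
have := dot_eq0 d0; move=> /(_ w); rewrite mem_bwords ws eqxx => /(_ isT) /eqP.
by rewrite mcoeffD mcoeffZ mulN1r addrC subr_eq0 => /eqP.
Qed.

(** P w is the orthogonal projection of [btensor w] on A, described as the element
    of A that represents the coefficient at w. *)
Definition reproducing (P : biword n -> T) := forall w,
  piece (shape w) (P w) /\
  forall x, piece (shape w) x -> hdot (shape w) x (P w) = x@_w.

Lemma kernel_exists : exists P, reproducing P.
Proof.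
suff /choice[P hP] : forall w, exists p, piece (shape w) p /\
    forall x, piece (shape w) x -> hdot (shape w) x p = x@_w by exists P.
move=> w.
pose V (f : biword n -> C) := exists2 x, piece (shape w) x & f = fun v => x@_v.
have [|r [Vr rE]] := @representer C _ (bwords (shape w)) V.
  split=> [|c _ _ [x hx ->] [y hy ->]].
    exists 0; first exact: piece0.
    by apply: funext => v; rewrite mcoeff0.
  exists (c *: x + y); first exact: piece_lin.
  by apply: funext => v; rewrite mcoeffD mcoeffZ.
have [p hp pE] := Vr w; exists p; split=> // x hx.
by rewrite /hdot -pE; apply: (rE w); rewrite ?mem_bwords //; exists x.
Qed.

Context (P : biword n -> T).
Hypothesis PP : reproducing P.

(** The matrix of the orthogonal projection on A; for the group of unitary matrices
    that fix A it is the mean of the matrix of the action. *)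
Definition ker w v : C := (P w)@_v.

Lemma kerE s x w : piece s x -> shape w = s -> hdot s x (P w) = x@_w.
Proof. by move=> hx ws; have [_] := PP w; rewrite ws; apply. Qed.

Lemma pieceP s w : shape w = s -> piece s (P w).
Proof. by move=> <-; case: (PP w). Qed.

Lemma ker_out w v : shape w != shape v -> ker w v = 0.
Proof. by move=> wv; apply: (piece_out (pieceP erefl)); rewrite eq_sym. Qed.

Lemma ker_herm w v : ker v w = (ker w v)^*.
Proof.
have [wv|wv] := eqVneq (shape w) (shape v); last first.
  by rewrite !ker_out ?rmorph0 // eq_sym.
rewrite /ker -(kerE (pieceP wv) erefl) -(kerE (pieceP (esym wv)) erefl).
by rewrite -wv -hdotC.
Qed.

Lemma ker_reproduce s x v : piece s x -> shape v = s ->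
  \sum_(w <- bwords s) x@_w * ker w v = x@_v.
Proof.
move=> hx vs; rewrite -(kerE hx vs); apply: eq_bigr => w _.
by rewrite ker_herm.
Qed.

(** A tensor fixed by the projection is a combination of the elements P w of A. *)
Lemma ker_mem s z : bihom s.1 s.2 z ->
  (forall v, shape v = s -> \sum_(w <- bwords s) z@_w * ker w v = z@_v) -> A z.
Proof.
move=> hz e.
suff -> : z = \sum_(w <- bwords s) z@_w *: (if shape w == s then P w else 0).
  set z' := \sum_(w <- _) _; suff: piece s z' by case.
  by apply: piece_sum => // w; case: eqP => [|_]; [exact: pieceP | exact: piece0].
apply/malgP => v; rewrite raddf_sum /=.
have [vs|vs] := eqVneq (shape v) s.
  rewrite -[LHS]e //; apply: eq_big_seq => w; rewrite mem_bwords => /eqP ws.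
  by rewrite ws eqxx mcoeffZ.
move/bihomP: hz => ->; last by rewrite -surjective_pairing.
rewrite big_seq big1 // => w; rewrite mem_bwords => /eqP ws.
by rewrite ws eqxx mcoeffZ -/(ker w v) ker_out ?mulr0 // ws eq_sym.
Qed.

Lemma ker_star w v : ker (wstar w) (wstar v) = (ker w v)^*.
Proof.
rewrite /ker; suff <- : star (P w) = P (wstar w).
  by rewrite starE -[(rev _, _)]/(wstar (wstar v)) wstarK.
have hs : piece (sswap (shape w)) (star (P w)).
  by apply: piece_star => //; exact: pieceP.
apply: (piece_eq hs); first by apply: pieceP; rewrite shape_star.
move=> z hz; rewrite (kerE hz) ?shape_star //.
have hz' : piece (shape w) (star z) by rewrite -(sswapK (shape w)); exact: piece_star.
have := congr1 Num.conj (kerE hz' erefl).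
rewrite [in X in _ = X -> _]starE conjCK => <-.
rewrite /hdot /dot big_bwords_star rmorph_sum; apply: eq_bigr => v' _ /=.
rewrite rmorphM /= !starE conjCK conjCK -[(rev _, _)]/(wstar (wstar v')) wstarK.
by rewrite conjCK.
Qed.

(** Composition with b maps A to A and so does its adjoint, composition with b^*;
    hence it commutes with the orthogonal projection.  The two sides are coefficients
    of b composed with the projection of a basis tensor, and of the projection of b
    composed with that basis tensor. *)
Lemma ker_comp s t (b : T) v w (u r : biword n) :
  piece (sadd s (sswap t)) b -> shape v = s -> shape w = t -> shape u = shape r ->
  \sum_(y <- bwords t) b@_(bimul v (wstar y)) * ker (bimul w r) (bimul y u) =
  \sum_(y <- bwords s) b@_(bimul y (wstar w)) * ker (bimul y r) (bimul v u).
Proof.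
move=> hb vs wt ur.
have hP : piece (sadd t (shape r)) (P (bimul w r)).
  by apply: pieceP; rewrite shape_bimul wt.
have [q hq qE] := piece_comp ccgA hb hP.
rewrite -(qE _ _ vs ur).
suff -> : q = \sum_(y <- bwords s) b@_(bimul y (wstar w)) *:
    (if shape y == s then P (bimul y r) else 0).
  rewrite raddf_sum /=; apply: eq_big_seq => y; rewrite mem_bwords => ys.
  by rewrite ys mcoeffZ.
apply: (piece_eq hq).
  apply: piece_sum => // y; case: eqP => [ys|_]; last exact: piece0.
  by apply: pieceP; rewrite shape_bimul ys.
move=> z hz.
have hb' : piece (sadd t (sswap s)) (star b).
  by rewrite -(sswapK t) -sswapD; exact: piece_star.
have [q2 hq2 q2E] := piece_comp ccgA hb' hz.
have bE (y y' : biword n) : (star b)@_(bimul y (wstar y')) = (b@_(bimul y' (wstar y)))^*.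
  by rewrite starE -[(rev _, _)]/(wstar _) wstar_mul wstarK.
rewrite hdot_sumr; transitivity (q2@_(bimul w r)).
  rewrite -(kerE hq2) ?shape_bimul ?wt // /hdot /dot !big_bwords_bimul.
  transitivity (\sum_(y <- bwords t) \sum_(y' <- bwords s)
      \sum_(u' <- bwords (shape r)) z@_(bimul y' u') *
       ((b@_(bimul y' (wstar y)))^* * ((P (bimul w r))@_(bimul y u'))^*)).
    rewrite [RHS]exchange_big; apply: eq_big_seq => y'; rewrite mem_bwords => /eqP ys.
    rewrite [RHS]exchange_big; apply: eq_big_seq => u'; rewrite mem_bwords => /eqP us.
    rewrite qE // rmorph_sum mulr_sumr; apply: eq_bigr => y _.
    by rewrite rmorphM.
  apply: eq_big_seq => y; rewrite mem_bwords => /eqP yt.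
  rewrite exchange_big; apply: eq_big_seq => u'; rewrite mem_bwords => /eqP us.
  rewrite q2E // mulr_suml; apply: eq_bigr => y' _.
  by rewrite bE mulrA [z@_ _ * _]mulrC.
rewrite q2E //; apply: eq_big_seq => y; rewrite mem_bwords => /eqP ys.
by rewrite bE ys eqxx (kerE hz) // shape_bimul ys.
Qed.

(** Block permutations are isometries preserving A in both directions, so they
    commute with the projection. *)
Lemma ker_swap (a b c a' b' c' : biword n) :
  shape a = shape a' -> shape b = shape b' -> shape c = shape c' ->
  ker (bimul a (bimul b c)) (bimul a' (bimul b' c')) =
  ker (bimul b (bimul a c)) (bimul b' (bimul a' c')).
Proof.
move=> ha hb hc.
have hP : piece (sadd (sadd (shape a) (shape b)) (shape c)) (P (bimul a (bimul b c))).
  by apply: pieceP; rewrite !shape_bimul saddA.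
have [q hq qE] := piece_swap ccgA idA hP.
rewrite {1}/ker -qE //.
suff -> : q = P (bimul b (bimul a c)) by [].
apply: (piece_eq hq).
  by apply: pieceP; rewrite !shape_bimul saddA [sadd (shape b) _]saddC.
move=> z hz; rewrite (kerE hz); last first.
  by rewrite !shape_bimul saddA [sadd (shape b) _]saddC.
have hz' : piece (sadd (sadd (shape b) (shape a)) (shape c)) z.
  by rewrite [sadd (shape b) _]saddC.
have [z' hz2 zE] := piece_swap ccgA idA hz'.
have hz3 : piece (sadd (sadd (shape a) (shape b)) (shape c)) z'.
  by rewrite [sadd (shape a) _]saddC.
rewrite -zE // -(kerE hz3); last by rewrite !shape_bimul saddA.
rewrite /hdot /dot [in LHS](saddC (shape a)) -!saddA !big_bwords_bimul.
under eq_bigr do rewrite big_bwords_bimul.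
under [RHS]eq_bigr do rewrite big_bwords_bimul.
rewrite exchange_big; apply: eq_big_seq => a1; rewrite mem_bwords => /eqP sa.
apply: eq_big_seq => b1; rewrite mem_bwords => /eqP sb.
apply: eq_big_seq => c1; rewrite mem_bwords => /eqP sc.
by rewrite zE // qE.
Qed.

End Kernel.

Arguments reproducing {C n} A P.

(** * Positivity of the kernel *)

Section Positivity.
Context {C : numClosedFieldType} {n : nat}.
Local Notation T := (mtensor C n).
Context {A : set T} (ccgA : is_ccg_star_subalgebra A) (idA : A idtensor).
Context (P : biword n -> T).
Local Notation piece := (piece A).
Hypothesis PP : reproducing A P.
Implicit Types (w v y u : biword n) (s t : nat * nat) (p q : biword n * biword n)
  (X Y Z : biword n * biword n -> C).

(** The matrix of the operator sending X to the sum of b X b^* over an orthonormal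
    basis b of A, with operators indexed by pairs of words. *)
Definition ker2 p q : C := ker P (bimul p.2 (wstar q.2)) (bimul p.1 (wstar q.1)).

Lemma ker2_herm p q : ker2 q p = (ker2 p q)^*.
Proof. by rewrite -(ker_star ccgA PP) !wstar_mul !wstarK. Qed.

Context (shs : seq (nat * nat)).

Definition pairs_of_shape s := [seq (v, w) | v <- bwords s, w <- bwords s].
(** Only operators preserving the shape of words occur, for finitely many shapes.
    They form a finite list of indices, on which [dot] is the Hilbert-Schmidt inner
    product. *)
Definition same_shape_pairs := [seq p | s <- shs, p <- pairs_of_shape s].

Lemma mem_pairs_of_shape s p :
  (p \in pairs_of_shape s) = (shape p.1 == s) && (shape p.2 == s).
Proof.
apply/allpairsP/andP => [[[v w] /= [+ + ->]]|[h1 h2]]; first by rewrite !mem_bwords.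
by exists p; rewrite !mem_bwords -surjective_pairing.
Qed.

Lemma mem_same_shape_pairs p :
  (p \in same_shape_pairs) = (shape p.1 == shape p.2) && (shape p.2 \in shs).
Proof.
apply/allpairsPdep/andP => [[s [q [+ + ->]]]|[/eqP h1 h2]].
  by rewrite mem_pairs_of_shape => hs /andP[/eqP -> /eqP ->].
by exists (shape p.2), p; rewrite mem_pairs_of_shape h1 eqxx.
Qed.

Lemma uniq_same_shape_pairs : uniq shs -> uniq same_shape_pairs.
Proof.
move=> uniq_shs; apply: allpairs_uniq_dep => // [s _|].
  by apply: allpairs_uniq => [||[? ?] [? ?] _ _]; rewrite ?uniq_bwords.
set st := [seq _ | _ <- _, _ <- _].
have key x : x \in st -> shape (tagged x).1 = tag x.
  by move=> /allpairsPdep[s [p [_ + ->]]]; rewrite mem_pairs_of_shape => /andP[/eqP].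
move=> [s p] [t q] /key /= + /key /= + pq.
by rewrite pq => <- <-.
Qed.

Lemma big_same_shape_pairs (V : nmodType) (F : biword n * biword n -> V) :
  \sum_(p <- same_shape_pairs) F p =
  \sum_(s <- shs) \sum_(v <- bwords s) \sum_(w <- bwords s) F (v, w).
Proof.
by rewrite big_allpairs_dep; apply: eq_bigr => s _; rewrite big_allpairs_dep.
Qed.

Definition average X p : C := \sum_(q <- same_shape_pairs) ker2 p q * X q.

Lemma averageD c X Y : average (fun p => c * X p + Y p) =
  fun p => c * average X p + average Y p.
Proof.
apply: funext => p; rewrite /average mulr_sumr -big_split.
by apply: eq_bigr => q _; rewrite mulrDr mulrCA.
Qed.

Lemma average_herm X Y :
  dot same_shape_pairs (average X) Y = dot same_shape_pairs X (average Y).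
Proof.
rewrite /dot /average; under eq_bigr do rewrite mulr_suml.
rewrite exchange_big; apply: eq_bigr => q _.
rewrite rmorph_sum mulr_sumr; apply: eq_bigr => p _.
by rewrite rmorphM /= -ker2_herm mulrAC mulrC.
Qed.

(** The operators Z with b Z = Z b for every b in A, stated entry by entry. *)
Definition commutant Z := forall s t (b : T), s \in shs -> t \in shs ->
  piece (sadd s (sswap t)) b -> forall v w, shape v = s -> shape w = t ->
  \sum_(y <- bwords t) b@_(bimul v (wstar y)) * Z (y, w) =
  \sum_(y <- bwords s) b@_(bimul y (wstar w)) * Z (v, y).

Lemma subspace_commutant : subspace commutant.
Proof.
split=> [s t b _ _ _ v w _ _|c X Y hX hY s t b hs ht hb v w hv hw].
  by rewrite !big1 // => y _; rewrite mulr0.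
under eq_bigr do rewrite mulrDr mulrCA.
under [RHS]eq_bigr do rewrite mulrDr mulrCA.
by rewrite !big_split -!mulr_sumr (hX s t) // (hY s t).
Qed.

(** Moving b through the sum of b' X b'^* over a basis is [ker_comp]. *)
Lemma average_commutant X : commutant (average X).
Proof.
move=> s t b hs ht hb v w hv hw; rewrite /average.
under eq_bigr do rewrite mulr_sumr.
under [RHS]eq_bigr do rewrite mulr_sumr.
rewrite exchange_big [RHS]exchange_big; apply: eq_big_seq => q.
rewrite mem_same_shape_pairs => /andP[/eqP q12 _].
under eq_bigr do rewrite mulrA.
under [RHS]eq_bigr do rewrite mulrA.
rewrite -!mulr_suml; congr (_ * _); rewrite /ker2 /=.
by apply: (ker_comp ccgA idA PP hb) => //; rewrite !shape_star q12.
Qed.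

(** On the commutant Z can be moved to the left of the elements of A, and the
    quadratic form becomes a sum of squared norms of the tensors [zeta]. *)
Lemma commutant_pos Z : commutant Z -> 0 <= dot same_shape_pairs (average Z) Z.
Proof.
move=> hZ.
suff -> : dot same_shape_pairs (average Z) Z =
    \sum_(s <- shs) \sum_(v <- bwords s) \sum_(t <- shs) \sum_(w' <- bwords t)
     \sum_(w <- bwords s) \sum_(y <- bwords s) (Z (v, w))^* * Z (v, y) *
       hdot (sadd s (sswap t)) (P (bimul w (wstar w'))) (P (bimul y (wstar w'))).
  apply: sumr_ge0 => s _; apply: sumr_ge0 => v _; apply: sumr_ge0 => t _.
  apply: sumr_ge0 => w' _.
  pose zeta := \sum_(w <- bwords s) (Z (v, w))^* *: P (bimul w (wstar w')).
  have : 0 <= hdot (sadd s (sswap t)) zeta zeta by exact: dot_ge0.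
  congr (_ <= _); rewrite {2}/zeta hdot_sumr exchange_big.
  apply: eq_bigr => y _; rewrite conjCK hdotC /zeta hdot_sumr rmorph_sum mulr_sumr.
  apply: eq_bigr => w _; rewrite rmorphM /= conjCK -hdotC mulrCA.
  by rewrite mulrA.
rewrite /dot big_same_shape_pairs; apply: eq_big_seq => s hs.
apply: eq_big_seq => v; rewrite mem_bwords => /eqP vs.
rewrite [RHS](eq_bigr (fun t => \sum_(w <- bwords s) \sum_(w' <- bwords t)
     \sum_(y <- bwords s) (Z (v, w))^* * Z (v, y) *
       hdot (sadd s (sswap t)) (P (bimul w (wstar w'))) (P (bimul y (wstar w')))));
  last by move=> t _; rewrite exchange_big.
rewrite exchange_big; apply: eq_big_seq => w; rewrite mem_bwords => /eqP ws.
rewrite /average big_same_shape_pairs mulr_suml; apply: eq_big_seq => t ht.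
rewrite exchange_big mulr_suml; apply: eq_big_seq => w'.
rewrite mem_bwords => /eqP ws'.
have hP : piece (sadd s (sswap t)) (P (bimul w (wstar w'))).
  by apply: (pieceP PP); rewrite shape_bimul shape_star ws ws'.
have := hZ s t _ hs ht hP v w' vs ws'; rewrite /ker2 /ker /= => ->.
rewrite mulr_suml; apply: eq_big_seq => y; rewrite mem_bwords => /eqP ys.
rewrite (kerE PP hP) ?shape_bimul ?shape_star ?ys ?ws' //.
by rewrite -mulrA mulrC; congr (_ * _); exact: mulrC.
Qed.

(** The averaging operator is self-adjoint with values in the commutant.  Hence it
    kills the part X1 of X orthogonal to the commutant, and its quadratic form at X
    only depends on the projection X0 of X on the commutant. *)
Lemma average_pos X : 0 <= dot same_shape_pairs (average X) X.
Proof.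
have [r [Cr rE]] := representer same_shape_pairs subspace_commutant.
pose X0 p := \sum_(q <- same_shape_pairs) X q * r q p.
have CX0 : commutant X0 by apply: subspace_sum => //; exact: subspace_commutant.
have X0E Z : commutant Z -> dot same_shape_pairs Z X0 = dot same_shape_pairs Z X.
  move=> CZ; rewrite dot_sumr; apply: eq_big_seq => q hq.
  by rewrite rE // mulrC.
pose X1 p := -1 * X0 p + X p.
have X1E Z : commutant Z -> dot same_shape_pairs Z X1 = 0.
  by move=> CZ; rewrite dotDr X0E // rmorphN1 mulN1r addNr.
(* By self-adjointness, the squared norm of the average of X1 is the inner product
   of X1 and its second average, which lies in the commutant. *)
have aX1 : {in same_shape_pairs, forall p, average X1 p = 0}.
  apply: dot_eq0; rewrite average_herm dotC average_herm.
  rewrite -average_herm X1E ?rmorph0 //; exact: average_commutant.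
have aX p : p \in same_shape_pairs -> average X p = average X0 p.
  move=> hp; have := aX1 p hp; rewrite /X1 averageD mulN1r => /eqP.
  by rewrite addrC subr_eq0 => /eqP.
have -> : dot same_shape_pairs (average X) X = dot same_shape_pairs (average X0) X0.
  rewrite X0E; last exact: average_commutant.
  by apply: eq_big_seq => p hp; rewrite aX.
exact: commutant_pos.
Qed.

End Positivity.

Section PositivityFamily.
Context {C : numClosedFieldType} {n : nat}.
Local Notation T := (mtensor C n).
Context {A : set T} (ccgA : is_ccg_star_subalgebra A) (idA : A idtensor).
Context (P : biword n -> T).
Local Notation piece := (piece A).
Hypothesis PP : reproducing A P.

Lemma ker_pos (I : eqType) (r : seq I) (c : I -> C) (a : I -> biword n * biword n) :
  (forall i, shape (a i).1 = shape (a i).2) ->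
  0 <= \sum_(i <- r) \sum_(j <- r) c i * (c j)^* * ker2 P (a i) (a j).
Proof.
move=> ha; pose shs := undup [seq shape (a i).2 | i <- r].
pose X (q : biword n * biword n) := \sum_(i <- r) (c i)^* * (q == a i)%:R.
have := average_pos ccgA idA PP shs X.
have ain i : i \in r -> a i \in same_shape_pairs shs.
  move=> ir; rewrite mem_same_shape_pairs ha eqxx /= mem_undup.
  by apply/mapP; exists i.
have us : uniq (same_shape_pairs (n := n) shs).
  by apply: uniq_same_shape_pairs; exact: undup_uniq.
congr (_ <= _); rewrite /dot.
transitivity (\sum_(p <- same_shape_pairs shs) \sum_(i <- r)
    (c i * average P shs X p) * (p == a i)%:R).
  apply: eq_bigr => p _; rewrite /X rmorph_sum mulr_sumr; apply: eq_bigr => i _.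
  by rewrite rmorphM /= conjCK rmorph_nat mulrCA mulrA.
rewrite exchange_big; apply: eq_big_seq => i ir.
rewrite (big_pick (fun p => c i * average P shs X p)) ?ain //.
rewrite /average mulr_sumr.
transitivity (\sum_(q <- same_shape_pairs shs) \sum_(j <- r)
    (c i * (c j)^* * ker2 P (a i) q) * (q == a j)%:R).
  apply: eq_bigr => q _; rewrite /X !mulr_sumr; apply: eq_bigr => j _.
  by rewrite !mulrA; congr (_ * _); rewrite mulrAC.
rewrite exchange_big; apply: eq_big_seq => j jr.
by rewrite (big_pick (fun q => c i * (c j)^* * ker2 P (a i) q)) ?ain.
Qed.

End PositivityFamily.

(** * Monomials in matrix entries and their conjugates *)

Section Monomials.
Context {n : nat}.
(** The letter (false, (i, j)) stands for the matrix entry U i j and the letter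
    (true, (i, j)) for its complex conjugate. *)
Definition letter := (bool * ('I_n * 'I_n))%type.
HB.instance Definition _ := Finite.on letter.
Implicit Types (s : seq letter) (x : letter) (m : {cmonom letter}).

Definition bar x : letter := (~~ x.1, x.2).

Lemma barK : involutive bar.
Proof. by case=> b ij; rewrite /bar /= negbK. Qed.

(** With f the first or the second projection, the row or the column indices of a
    product of entries.  As a unitary matrix acts on V* by its conjugate, conjugated entries
    contribute to the V*-part. *)
Definition indices (f : 'I_n * 'I_n -> 'I_n) s : biword n :=
  ([seq f x.2 | x <- s & ~~ x.1], [seq f x.2 | x <- s & x.1]).

Lemma indices_cat f s s' : indices f (s ++ s') = bimul (indices f s) (indices f s').
Proof. by rewrite /indices !filter_cat !map_cat. Qed.

Lemma indices_bar f s : indices f (rev (map bar s)) = wstar (indices f s).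
Proof.
rewrite /indices /wstar /= !filter_rev !map_rev !filter_map -!map_comp.
by congr (rev _, rev _); congr map; apply: eq_filter => x /=; rewrite ?negbK.
Qed.

Lemma shape_indices f g s : shape (indices f s) = shape (indices g s).
Proof. by rewrite /shape /= !size_map. Qed.

(** The entries whose product is the matrix coefficient of the action at (v, w). *)
Definition entries (v w : biword n) : seq letter :=
  [seq (false, ij) | ij <- zip v.1 w.1] ++ [seq (true, ij) | ij <- zip v.2 w.2].

Lemma indices_entries v w : shape v = shape w ->
  indices fst (entries v w) = v /\ indices snd (entries v w) = w.
Proof.
case: v w => [v1 v2] [w1 w2] [s1 s2].
have e1 b r : [seq x <- [seq (b, ij) | ij <- r] | ~~ x.1] =
    if b then [::] else [seq (b, ij) | ij <- r] :> seq letter.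
  by case: b; elim: r => //= ij r ->.
have e2 b r : [seq x <- [seq (b, ij) | ij <- r] | x.1] =
    if b then [seq (b, ij) | ij <- r] else [::] :> seq letter.
  by case: b; elim: r => //= ij r ->.
have e3 b (f : 'I_n * 'I_n -> 'I_n) r : [seq f x.2 | x <- [seq (b, ij) | ij <- r]] =
    [seq f ij | ij <- r] by rewrite -map_comp.
rewrite /indices !filter_cat !e1 !e2 /= cats0 !e3.
by rewrite -!/(unzip1 _) -!/(unzip2 _) !unzip1_zip ?unzip2_zip ?s1 ?s2.
Qed.

(** Expectations are defined on words in the letters, so a representative of each
    commutative monomial is needed. *)
Definition seq_of_cmonom m : seq letter :=
  flatten [seq nseq (m x) x | x <- enum {: letter}].

Fixpoint cmonom_of_seq s : {cmonom letter} :=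
  if s is x :: s' then mmul (ucm x) (cmonom_of_seq s') else mone.

Lemma count_seq_of_cmonom m x : count_mem x (seq_of_cmonom m) = m x.
Proof.
rewrite /seq_of_cmonom count_flatten -map_comp sumnE big_map.
rewrite (eq_bigr (fun y => (m y * (y == x))%N)) => [|y _]; last first.
  by rewrite /= count_nseq mulnC.
rewrite (bigD1_seq x) ?enum_uniq ?mem_enum //= eqxx muln1 big1 ?addn0 //.
by move=> y /negbTE ->; rewrite muln0.
Qed.

Lemma cmonom_of_seqE s x : cmonom_of_seq s x = count_mem x s.
Proof. by elim: s => [|y s IH] /=; rewrite ?cm1 // cmM cmU IH. Qed.

Lemma perm_seq_of_cmonom (m : {cmonom letter}) s :
  (forall x, m x = count_mem x s) -> perm_eq (seq_of_cmonom m) s.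
Proof. by move=> e; apply/allP => x _; rewrite /= count_seq_of_cmonom e. Qed.

Lemma cmonom_of_seq_cat s s' : cmonom_of_seq (s ++ s') =
  mmul (cmonom_of_seq s) (cmonom_of_seq s').
Proof. by elim: s => [|x s IH] /=; rewrite ?mul1m // IH mulmA. Qed.

Lemma seq_of_cmonomK m : cmonom_of_seq (seq_of_cmonom m) = m.
Proof. by apply/eqP/cmP => x; rewrite cmonom_of_seqE count_seq_of_cmonom. Qed.

Definition cmonom_bar m : {cmonom letter} := cmonom_of_seq (map bar (seq_of_cmonom m)).

Lemma cmonom_barE m x : cmonom_bar m x = m (bar x).
Proof.
rewrite /cmonom_bar cmonom_of_seqE count_map -[RHS]count_seq_of_cmonom; apply: eq_count => y /=.
by rewrite inv_eq //; exact: barK.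
Qed.

Lemma cmonom_barM m m' : cmonom_bar (mmul m m') = mmul (cmonom_bar m) (cmonom_bar m').
Proof. by apply/eqP/cmP => x; rewrite !(cmM, cmonom_barE). Qed.

Lemma cmonom_bar1 : cmonom_bar mone = mone.
Proof. by apply/eqP/cmP => x; rewrite cmonom_barE !cm1. Qed.

End Monomials.
Arguments letter n : clear implicits.

(** * The ring of polynomials in matrix entries and their conjugates *)

Section CoordinateRing.
Context {C : numClosedFieldType} {n : nat}.
Local Notation M := {cmonom letter n}.
Local Notation AA := {malg C[M]}.
Implicit Types (g h p q : AA) (m : M) (s : seq (letter n)) (x : letter n).

Fact monomial_key : unit. Proof. by []. Qed.
(** The lock prevents unification from comparing polynomials by computing them. *)
Definition monomial : seq (letter n) -> AA :=
  locked_with monomial_key (fun s => << cmonom_of_seq s >>).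

Lemma monomialE s : monomial s = << cmonom_of_seq s >>.
Proof. by rewrite /monomial unlock. Qed.

Lemma monomial_nil : monomial [::] = 1.
Proof. by rewrite monomialE. Qed.

Lemma monomial_cat s s' : monomial (s ++ s') = monomial s * monomial s'.
Proof. by rewrite !monomialE cmonom_of_seq_cat malgM_def fgmulUU mulr1. Qed.

Lemma term_mul c d s s' :
  (c%:MP * monomial s) * (d%:MP * monomial s') = (c * d)%:MP * monomial (s ++ s').
Proof. by rewrite mulrACA; congr (_ * _); [rewrite mpolyCM | rewrite monomial_cat]. Qed.

Lemma monomial_seq_of_cmonom m : monomial (seq_of_cmonom m) = << m >>.
Proof. by rewrite monomialE seq_of_cmonomK. Qed.

Lemma malg_expand g : g = \sum_(m <- msupp g) (g@_m)%:MP * monomial (seq_of_cmonom m).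
Proof.
rewrite {1}[g]monalgE; apply: eq_bigr => m _.
by rewrite monomial_seq_of_cmonom malgM_def fgmulUU mulr1 mul1m.
Qed.

Definition bar_monomial m : AA := << cmonom_bar m >>.

Fact bar_monomial_mmorphism : mmorphism bar_monomial.
Proof.
split=> [m m'|]; rewrite /bar_monomial ?cmonom_barM ?cmonom_bar1 //.
by rewrite malgM_def fgmulUU mulr1.
Qed.
HB.instance Definition _ :=
  monalg.isMultiplicative.Build M AA bar_monomial bar_monomial_mmorphism.

(** The adjoint of a polynomial: conjugates the coefficients and exchanges each entry
    with its conjugate. *)
Definition adj : {rmorphism AA -> AA} := mmap (malgC \o Num.conj) bar_monomial.

Lemma adjC c : adj c%:MP = (Num.conj c)%:MP.
Proof. by rewrite /adj /= mmapU /= /bar_monomial cmonom_bar1 mulr1. Qed.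

Lemma adj_monomial s : adj (monomial s) = monomial (map bar s).
Proof.
rewrite !monomialE /adj /= mmapU /= rmorph1 mul1r /bar_monomial; congr << _ >>.
apply/eqP/cmP => x; rewrite cmonom_barE !cmonom_of_seqE count_map; apply: eq_count => y /=.
by rewrite inv_eq //; exact: barK.
Qed.

Lemma adj_term c s : adj (c%:MP * monomial s) = (Num.conj c)%:MP * monomial (map bar s).
Proof. by rewrite rmorphM; congr (_ * _); [exact: adjC | exact: adj_monomial]. Qed.

Lemma adj_expand g :
  adj g = \sum_(m <- msupp g) (Num.conj g@_m)%:MP * monomial (map bar (seq_of_cmonom m)).
Proof.
rewrite {1}[g]malg_expand rmorph_sum; apply: eq_bigr => m _.
exact: adj_term.
Qed.

Lemma adjK : involutive adj.
Proof.
move=> g; have adj2 p q : adj (adj (p + q)) = adj (adj p) + adj (adj q).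
  by rewrite !rmorphD.
rewrite (malg_expand g) (big_morph (fun p => adj (adj p)) adj2 (id1 := 0)) ?rmorph0 //.
apply: eq_bigr => m _; rewrite !adj_term conjCK.
by rewrite -map_comp (eq_map (g := id)) ?map_id // => x; exact: barK.
Qed.

Section Functional.
Context (F : seq (letter n) -> C).
Hypothesis F_perm : forall s s', perm_eq s s' -> F s = F s'.

(** The linear functional whose value at each monomial is that of F at any word
    representing it. *)
Definition linear_ext g : C := \sum_(m <- msupp g) g@_m * F (seq_of_cmonom m).

Lemma linear_extE g : linear_ext g = mmap (@idfun C) (fun m => F (seq_of_cmonom m)) g.
Proof. by []. Qed.

Lemma linear_extD g h : linear_ext (g + h) = linear_ext g + linear_ext h.
Proof. by rewrite !linear_extE mmapD. Qed.

Lemma linear_ext_sum I (r : seq I) (G : I -> AA) :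
  linear_ext (\sum_(i <- r) G i) = \sum_(i <- r) linear_ext (G i).
Proof. by apply: (big_morph _ linear_extD); rewrite linear_extE mmap0. Qed.

Lemma linear_extZ c g : linear_ext (c%:MP * g) = c * linear_ext g.
Proof.
rewrite mul_malgC !linear_extE (mmapEw (msuppZ_le _ _)) mmapE mulr_sumr.
by apply: eq_bigr => m _; rewrite mcoeffZ /= mulrA.
Qed.

Lemma linear_ext_monomial s : linear_ext (monomial s) = F s.
Proof.
rewrite linear_extE monomialE mmapU /= mul1r; apply: F_perm; apply: perm_seq_of_cmonom => x.
exact: cmonom_of_seqE.
Qed.

End Functional.
End CoordinateRing.

(** * The expectation attached to the algebra *)

Section KernelState.
Context {R : realType} {n : nat}.
Local Notation C := R[i].
Local Notation T := (mtensor C n).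
Local Notation AA := {malg C[{cmonom letter n}]}.
Context {A : set T} (ccgA : is_ccg_star_subalgebra A) (idA : A idtensor).
Context (P : biword n -> T).
Local Notation piece := (piece A).
Hypothesis PP : reproducing A P.
Implicit Types (p q : AA) (s : seq (letter n)) (u v w y r : biword n).

(** The case of [ker_comp] where the source of b is the empty word: multiplication
    by an element of A commutes with the projection. *)
Lemma ker_mul t (b : T) v u r : piece t b -> shape v = t -> shape u = shape r ->
  \sum_(y <- bwords t) b@_y * ker P (bimul y r) (bimul v u) = b@_v * ker P r u.
Proof.
move=> hb vs ur.
have hb0 : piece (sadd t (sswap (0, 0)%N)) b by rewrite saddC; case: t hb {vs}.
have := ker_comp ccgA idA PP hb0 vs (erefl : shape (bione n) = (0, 0)%N) ur.
rewrite [X in X = _ -> _]big_seq1 -[(_, _)]/(bione n) -[wstar _]/(bione n).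
rewrite -[bimul v (bione n)]/(mmul v mone) mulm1.
rewrite -![bimul (bione n) _]/(mmul mone _) !mul1m => ->.
by apply: eq_bigr => y _; rewrite -[bimul y (bione n)]/(mmul y mone) mulm1.
Qed.

(** The expectation of a product of entries and conjugates of entries. *)
Definition moment s : C := ker P (indices snd s) (indices fst s).

(** By [ker_swap], as permutations of words are generated by block swaps. *)
Lemma moment_perm s s' : perm_eq s s' -> moment s = moment s'.
Proof.
apply: catCA_perm_subst => s1 s2 s3; rewrite /moment !indices_cat.
by apply: (ker_swap ccgA idA PP); exact: shape_indices.
Qed.

Lemma moment_bar s : moment (map bar s) = Num.conj (moment s).
Proof.
rewrite (moment_perm (_ : perm_eq _ (rev (map bar s)))).
  by rewrite /moment !indices_bar (ker_star ccgA PP).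
by rewrite perm_sym perm_rev.
Qed.

Lemma moment_nil : moment [::] = 1.
Proof.
have h1 : piece (shape (bione n)) 1.
  split; first by case: ccgA => -[/set_mem].
  by have := @bihom_btensor C n (bione n); rewrite btensor1.
have := ker_reproduce PP h1 erefl; rewrite big_seq1 -[(_, _)]/(bione n).
by rewrite -btensor1 mcoeff_btensor eqxx mul1r.
Qed.

Definition expectation p : C := linear_ext moment p.

(** The polynomial that evaluates at a unitary matrix U to the coefficient at v of
    act U z - z. *)
Definition fix_equation (z : T) v : AA :=
  \sum_(y <- bwords (shape v)) (z@_y)%:MP * monomial (entries v y) - (z@_v)%:MP.

Lemma expectationB p q : expectation (p - q) = expectation p - expectation q.
Proof.
rewrite /expectation linear_extD -[- q]mulN1r -(rmorphN1 (@malgC _ C)) linear_extZ mulN1r //.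
Qed.

Lemma expectation_fix_equation (z : T) v : expectation (fix_equation z v) =
  \sum_(y <- bwords (shape v)) z@_y * ker P y v - z@_v.
Proof.
rewrite expectationB /expectation linear_ext_sum; congr (_ - _).
  apply: eq_big_seq => y; rewrite mem_bwords => /eqP ys.
  have [e1 e2] := indices_entries (esym ys).
  by rewrite linear_extZ (linear_ext_monomial moment_perm) /moment e1 e2.
rewrite -[_%:MP]mulr1 linear_extZ -monomial_nil (linear_ext_monomial moment_perm).
by rewrite moment_nil mulr1.
Qed.

Lemma fix_equation_null (b : T) v p : A b -> expectation (fix_equation b v * p) = 0.
Proof.
move=> Ab; pose b' := hcomp (shape v).1 (shape v).2 b.
have bE y : shape y = shape v -> b@_y = b'@_y.
  by rewrite /b' hcompE => -[-> ->]; rewrite !eqxx.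
have hb : piece (shape v) b'.
  split; last exact: hcomp_bihom.
  by case: (ccgA) => alg gr _ _; exact: (gradedP alg).1 gr _ _ _ Ab.
suff E s : expectation (fix_equation b v * monomial s) = 0.
  rewrite [p]malg_expand mulr_sumr /expectation linear_ext_sum big1 // => m _.
  by rewrite (mulrCA (fix_equation b v)) linear_extZ -/(expectation _) E mulr0.
have -> : fix_equation b v * monomial s =
    \sum_(y <- bwords (shape v)) (b@_y)%:MP * monomial (entries v y ++ s) - (b@_v)%:MP * monomial s.
  etransitivity; first exact: mulrBl.
  apply: (congr2 (fun a c : AA => a - c)) => //.
  etransitivity; first exact: mulr_suml.
  by apply: eq_bigr => y _; rewrite monomial_cat; exact/esym/mulrA.
rewrite expectationB.
transitivity (b@_v * moment s - b@_v * moment s); last exact: subrr.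
congr (_ - _); last by rewrite /expectation linear_extZ (linear_ext_monomial moment_perm).
have us : shape (indices fst s) = shape (indices snd s) by exact: shape_indices.
rewrite bE // [X in _ = _ * X]/moment -(ker_mul hb (erefl (shape v)) us) /expectation linear_ext_sum.
apply: eq_big_seq => y; rewrite mem_bwords => /eqP ys.
have [e1 e2] := indices_entries (esym ys).
rewrite linear_extZ (linear_ext_monomial moment_perm) bE // /moment.
by rewrite !(indices_cat _ (entries v y)) e1 e2.
Qed.

Lemma expectation_adj p : expectation (adj p) = Num.conj (expectation p).
Proof.
rewrite adj_expand.
have -> : expectation p = \sum_(m <- msupp p) p@_m * moment (seq_of_cmonom m) by [].
rewrite /expectation linear_ext_sum rmorph_sum.
apply: eq_bigr => m _; rewrite [LHS]linear_extZ (linear_ext_monomial moment_perm) moment_bar.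
by rewrite [RHS]rmorphM.
Qed.

Lemma expectation_pos p : 0 <= expectation (p * adj p).
Proof.
have -> : expectation (p * adj p) = \sum_(m <- msupp p) \sum_(m' <- msupp p)
   p@_m * (Num.conj p@_m') * ker2 P (indices fst (seq_of_cmonom m), indices snd (seq_of_cmonom m))
     (indices fst (seq_of_cmonom m'), indices snd (seq_of_cmonom m')).
  rewrite adj_expand [X in expectation (X * _)](malg_expand p).
  rewrite mulr_suml /expectation linear_ext_sum.
  apply: eq_bigr => m _; rewrite mulr_sumr linear_ext_sum; apply: eq_bigr => m' _.
  rewrite term_mul linear_extZ (linear_ext_monomial moment_perm); congr (_ * _).
  rewrite (moment_perm (_ : perm_eq _ (seq_of_cmonom m ++ rev (map bar (seq_of_cmonom m'))))).
    by rewrite /moment !(indices_cat _ (seq_of_cmonom m)) !indices_bar.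
  by rewrite perm_cat2l perm_sym perm_rev.
apply: (ker_pos ccgA idA PP) => m; exact: shape_indices.
Qed.

End KernelState.

(** * Complex-valued states and their values on generators *)

Section ComplexStates.
Context {R : realType} {AA : comNzRingType}.
Local Notation C := R[i].
Context (cst : {rmorphism C -> AA}) (adj : {rmorphism AA -> AA}).
Hypotheses (adj_cst : forall c, adj (cst c) = cst (Num.conj c)) (adjK : involutive adj).
Implicit Types (p q g : AA).

Definition real_scalar : {rmorphism R -> AA} := cst \o (real_complex R).

Lemma Re_conj (z : C) : complex.Re (Num.conj z) = complex.Re z.
Proof. by case: z. Qed.

Lemma ReD (z t : C) : complex.Re (z + t) = complex.Re z + complex.Re t.
Proof. by case: z t => [? ?] [? ?]. Qed.

Lemma ReZ (r : R) (z : C) : complex.Re (r%:C%C * z) = r * complex.Re z.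
Proof. by case: z => a b /=; rewrite mul0r subr0. Qed.

Lemma adj_real_scalar r : adj (real_scalar r) = real_scalar r.
Proof.
rewrite adj_cst; congr (cst _); apply/eqP.
by rewrite eq_complex /= oppr0 !eqxx.
Qed.

Definition imag : AA := cst 'i%C.

Lemma imag_imag p : imag * (imag * p) = - p.
Proof. by rewrite mulrA -rmorphM -expr2 sqr_i rmorphN1 mulN1r. Qed.

Lemma adj_imag : adj imag = - imag.
Proof.
rewrite adj_cst -rmorphN; congr (cst _).
by apply/eqP; rewrite eq_complex /= oppr0 !eqxx.
Qed.

Definition re_part g : AA := g + adj g.
Definition im_part g : AA := imag * (g - adj g).

Lemma re_part_adj g : adj (re_part g) = re_part g.
Proof. by rewrite rmorphD adjK addrC. Qed.

Lemma im_part_adj g : adj (im_part g) = im_part g.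
Proof. by rewrite rmorphM rmorphB adj_imag adjK mulNr -mulrN opprB. Qed.

Section Extension.
Context (B : AA -> R) (Z : AA -> Prop) (L : AA -> R).
Hypothesis stL : state real_scalar adj B Z L.

(** Real states are used for the order arguments; this is the complex-linear
    functional with real part L. *)
Definition cplx p : C := (L p -i* L (imag * p))%C.

Lemma cplxD p q : cplx (p + q) = cplx p + cplx q.
Proof.
rewrite /cplx mulrDr !(stateD stL).
by apply/eqP; rewrite eq_complex /= opprD !eqxx.
Qed.

Lemma cplx1 : cplx 1 = 1.
Proof.
have : L imag = - L imag by rewrite -(stateN stL) -adj_imag (state_herm stL).
move=> h; have {}h : L imag = 0 by lra.
by rewrite /cplx mulr1 h (state1 stL) oppr0.
Qed.

Lemma cplx_real_scalar r p : cplx (real_scalar r * p) = r%:C%C * cplx p.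
Proof.
rewrite /cplx mulrCA !(stateZ stL).
by apply/eqP; rewrite eq_complex /=; apply/andP; split; apply/eqP; ring.
Qed.

Lemma cplx_imag p : cplx (imag * p) = 'i%C * cplx p.
Proof.
rewrite /cplx imag_imag (stateN stL).
by apply/eqP; rewrite eq_complex /=; apply/andP; split; apply/eqP; ring.
Qed.

Lemma cplxZ c p : cplx (cst c * p) = c * cplx p.
Proof.
have -> : cst c = real_scalar (complex.Re c) + imag * real_scalar (complex.Im c).
  by rewrite {1}[c]complexE rmorphD rmorphM.
by rewrite mulrDl cplxD cplx_real_scalar -mulrA cplx_imag cplx_real_scalar mulrA -mulrDl -complexE.
Qed.

Lemma cplx_null g p : Z g -> cplx (g * p) = 0.
Proof.
move=> Zg; rewrite /cplx (state_null stL) // mulrCA (state_null stL) //.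
by rewrite oppr0.
Qed.

Lemma cplx_mul_const h c p : Z (h - real_scalar c) -> cplx (h * p) = c%:C%C * cplx p.
Proof.
move=> Zh; have := cplx_null p Zh; rewrite -cplx_real_scalar -{2}[h](subrK (real_scalar c)).
by rewrite [in X in _ -> X]mulrDl cplxD => ->; rewrite add0r.
Qed.

(** Since g = (re_part g - i * im_part g) / 2, a state for which both parts act as
    constants also turns multiplication by g into multiplication by a number. *)
Lemma cplx_eval (c : AA -> R) g p :
  Z (re_part g - real_scalar (c (re_part g))) -> Z (im_part g - real_scalar (c (im_part g))) ->
  let e := (c (re_part g) -i* c (im_part g))%C / 2 in
  cplx (g * p) = e * cplx p /\ cplx (adj g * p) = Num.conj e * cplx p.
Proof.
move=> Zre Zim e.
have cre := cplx_mul_const p Zre.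
have cim : cplx (imag * im_part g * p) = 'i%C * ((c (im_part g))%:C%C * cplx p).
  by rewrite -mulrA cplx_imag (cplx_mul_const p Zim).
have imE : imag * im_part g = - (g - adj g) by rewrite imag_imag.
have E (z : C) x : 2 * cplx x = (2 * z) * cplx p -> cplx x = z * cplx p.
  by rewrite -mulrA => /(mulfI _) ->; rewrite // pnatr_eq0.
have D x : 2 * cplx x = cplx (x + x) by rewrite cplxD -mulr2n mulr_natl.
split; apply: E; rewrite D -mulrDl.
  have -> : g + g = re_part g + (- 1) * (imag * im_part g).
    by rewrite imE /re_part; ring.
  rewrite [in LHS]mulrDl cplxD cre -(rmorphN1 cst) -(mulrA (cst (-1))) cplxZ cim !mulrA -mulrDl.
  congr (_ * _); rewrite [RHS]mulrAC divff ?mul1r ?pnatr_eq0 //.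
  by apply/eqP; rewrite eq_complex /=; apply/andP; split; apply/eqP; ring.
have -> : adj g + adj g = re_part g + imag * im_part g.
  by rewrite imE /re_part; ring.
rewrite [in LHS]mulrDl cplxD cre cim !mulrA -mulrDl.
congr (_ * _); rewrite /e rmorphM fmorphV rmorph_nat [RHS]mulrC divfK ?pnatr_eq0 //.
by apply/eqP; rewrite eq_complex /=; apply/andP; split; apply/eqP; ring.
Qed.

End Extension.
End ComplexStates.

(** * Bounded elements and the existence of characters *)

Lemma linear_relation {K : pzRingType} {AA : pzRingType} (cst : {rmorphism K -> AA})
    (E : AA -> K) (I : Type) (r : seq I) (c : I -> K) (G : I -> AA) d p :
  (forall p q, E (p + q) = E p + E q) -> (forall c p, E (cst c * p) = c * E p) ->
  E ((\sum_(i <- r) cst (c i) * G i - cst d) * p) =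
  \sum_(i <- r) c i * E (G i * p) - d * E p.
Proof.
move=> ED EZ; have E0 : E 0 = 0 by rewrite -[0](mulr0 (cst 0)) EZ mul0r.
rewrite mulrBl mulr_suml ED -(mulNr (cst d)) -(rmorphN cst) EZ mulNr (big_morph _ ED E0).
by congr (_ - _); apply: eq_bigr => i _; rewrite -mulrA EZ.
Qed.

Section Bounded.
Context {R : realType} {AA : comNzRingType}.
Local Notation C := R[i].
Context (cst : {rmorphism C -> AA}) (adj : {rmorphism AA -> AA}).
Hypotheses (adj_cst : forall c, adj (cst c) = cst (Num.conj c)).
Context (E : AA -> C).
Hypotheses (ED : forall p q, E (p + q) = E p + E q)
  (EZ : forall c p, E (cst c * p) = c * E p) (E1 : E 1 = 1)
  (Eadj : forall p, E (adj p) = Num.conj (E p))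
  (Epos : forall p, 0 <= E (p * adj p)).
Implicit Types (p q g : AA).

Definition re_of p : R := complex.Re (E p).

Lemma re_of_pos p : 0 <= re_of (p * adj p).
Proof. by have := Epos p; rewrite lecE => /andP[]. Qed.

Lemma re_ofD p q : re_of (p + q) = re_of p + re_of q.
Proof. by rewrite /re_of ED ReD. Qed.

Lemma re_ofZ r p : re_of (real_scalar cst r * p) = r * re_of p.
Proof. by rewrite /re_of EZ ReZ. Qed.

(** A bound for multiplication by p on the pre-Hilbert space attached to E. *)
Definition bounded p := exists2 b, 0 <= b &
  forall q, re_of (q * adj q * (p * adj p)) <= b * re_of (q * adj q).

Lemma bounded_cst c : bounded (cst c).
Proof.
pose r := complex.Re (c * Num.conj c).
have e : c * Num.conj c = r%:C%C.
  by apply/eqP; rewrite eq_complex; case: (c) @r => a b /=; rewrite eqxx; apply/eqP; ring.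
have r0 : 0 <= r by have := mul_conjC_ge0 c; rewrite e lecE => /andP[].
exists r => // q; rewrite adj_cst -rmorphM e [q * _ * _]mulrC.
by rewrite -[cst r%:C%C]/(real_scalar cst r) re_ofZ.
Qed.

Lemma boundedM p p' : bounded p -> bounded p' -> bounded (p * p').
Proof.
move=> [b b0 hb] [b' b'0 hb']; exists (b' * b) => [|q]; first exact: mulr_ge0.
have -> : q * adj q * (p * p' * adj (p * p')) =
    (q * p) * adj (q * p) * (p' * adj p') by rewrite !rmorphM; ring.
apply: le_trans (hb' _) _; rewrite -(mulrA b' b) ler_wpM2l //.
have -> : (q * p) * adj (q * p) = q * adj q * (p * adj p) by rewrite rmorphM; ring.
exact: hb.
Qed.

(** The parallelogram law. *)
Lemma boundedD p p' : bounded p -> bounded p' -> bounded (p + p').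
Proof.
move=> [b b0 hb] [b' b'0 hb']; exists (2 * (b + b')) => [|q].
  by rewrite mulr_ge0 // addr_ge0.
have := re_of_pos (q * (p - p')).
have e : q * (p - p') * adj (q * (p - p')) + q * adj q * ((p + p') * adj (p + p')) =
   (q * adj q * (p * adj p) + q * adj q * (p' * adj p')) +
   (q * adj q * (p * adj p) + q * adj q * (p' * adj p')).
  by rewrite rmorphM rmorphB rmorphD; ring.
have := congr1 re_of e; rewrite !re_ofD => {}e h.
by have := hb q; have := hb' q; lra.
Qed.

Lemma bounded_adj p : involutive adj -> bounded p -> bounded (adj p).
Proof. by move=> adjK [b b0 hb]; exists b => // q; rewrite adjK [adj p * p]mulrC. Qed.

Lemma re_of_sum I (r : seq I) (G : I -> AA) :
  re_of (\sum_(i <- r) G i) = \sum_(i <- r) re_of (G i).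
Proof.
apply: (big_morph _ re_ofD).
by rewrite -(rmorph0 (real_scalar cst)) -[real_scalar _ 0]mulr1 re_ofZ mul0r.
Qed.

(** If the squared moduli of the G j add up to 1, each of them is at most 1. *)
Lemma bounded_row (J : finType) (G : J -> AA) :
  (forall p, \sum_j E (G j * adj (G j) * p) = E p) -> forall j, bounded (G j).
Proof.
move=> hG j; exists 1 => // q; rewrite mul1r.
have -> : re_of (q * adj q) = \sum_i re_of (q * adj q * (G i * adj (G i))).
  have E0 : E 0 = 0 by rewrite -[0](mulr0 (cst 0)) EZ mul0r.
  rewrite -re_of_sum /re_of -hG (big_morph _ ED E0); congr (complex.Re _).
  by apply: eq_bigr => i _; rewrite mulrC.
rewrite (bigD1 j) //= lerDl; apply: sumr_ge0 => i _.
have -> : q * adj q * (G i * adj (G i)) = (q * G i) * adj (q * G i).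
  by rewrite rmorphM; ring.
exact: re_of_pos.
Qed.

Lemma bounded_sum I (r : seq I) (G : I -> AA) :
  (forall i, bounded (G i)) -> bounded (\sum_(i <- r) G i).
Proof.
move=> hG; apply: big_ind => //; last exact: boundedD.
by rewrite -(rmorph0 cst); exact: bounded_cst.
Qed.

Lemma bounded_state : (forall p, bounded p) -> exists B : AA -> R,
  state (real_scalar cst) adj B (fun g => forall p, E (g * p) = 0) re_of.
Proof.
move=> hb.
have /choice[B hB] : forall p, exists b,
    forall q, re_of (q * adj q * (p * adj p)) <= b * re_of (q * adj q).
  by move=> p; have [b _ h] := hb p; exists b.
exists B; split => //.
- by move=> r p q; rewrite re_ofD re_ofZ.
- by rewrite /re_of E1.
- by move=> p; rewrite /re_of Eadj Re_conj.
- exact: re_of_pos.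
- by move=> g p h; rewrite /re_of h.
Qed.

End Bounded.

(** A functional maximizing h and then every real and imaginary part of the
    generators is a character on the algebra they generate.  Here h is the sum
    of conj (E q) * q and its adjoint, so that E (h) > 0 while h vanishes at the zeros
    of q; as the maximum of h is at least E (h), the character is not a zero of q. *)
Lemma character_exists {R : realType} {AA : comNzRingType} (cst : {rmorphism R[i] -> AA})
    (adj : {rmorphism AA -> AA}) (E : AA -> R[i]) (X : finType) (g : X -> AA) (q : AA) :
  (forall c, adj (cst c) = cst (Num.conj c)) -> involutive adj ->
  (forall p p', E (p + p') = E p + E p') -> (forall c p, E (cst c * p) = c * E p) ->
  E 1 = 1 -> (forall p, E (adj p) = Num.conj (E p)) ->
  (forall p, 0 <= E (p * adj p)) ->
  (forall p, bounded adj E p) -> E q != 0 ->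
  exists (psi : AA -> R[i]) (e : X -> R[i]),
    [/\ forall p p', psi (p + p') = psi p + psi p',
        forall c p, psi (cst c * p) = c * psi p, psi 1 = 1 & psi q != 0] /\
    [/\ forall x p, psi (g x * p) = e x * psi p,
        forall x p, psi (adj (g x) * p) = Num.conj (e x) * psi p &
        forall p, (forall p', E (p * p') = 0) -> psi p = 0].
Proof.
move=> adj_cst adjK ED EZ E1 Eadj Epos hb Eq.
have [B st0] := bounded_state ED EZ E1 Eadj Epos hb.
have areal := adj_real_scalar adj_cst.
pose h0 := cst (Num.conj (E q)) * q; pose h := h0 + adj h0.
have hh : adj h = h by rewrite /h rmorphD adjK addrC.
have h_gt0 : 0 < re_of E h.
  have : 0 < re_of E h0.
    have := mul_conjC_gt0 (E q); rewrite Eq /re_of /h0 EZ mulrC ltcE => /andP[_].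
    by [].
  by rewrite (stateD st0) (state_herm st0) => h0_gt0; rewrite addr_gt0.
have [c0 c0h [L1 st1]] := state_peak adjK areal hh st0.
pose hs := [seq re_part adj (g x) | x <- enum X] ++ [seq im_part cst adj (g x) | x <- enum X].
have hsE y : y \in hs -> adj y = y.
  rewrite mem_cat => /orP[] /mapP[x _ ->]; first exact: (re_part_adj adjK).
  exact: (im_part_adj adj_cst adjK).
have [c [L st]] := state_peaks adjK areal hsE st1.
pose psi := cplx cst L.
pose e x := (c (re_part adj (g x)) -i* c (im_part cst adj (g x)))%C / 2.
have ev x p : psi (g x * p) = e x * psi p /\ psi (adj (g x) * p) = Num.conj (e x) * psi p.
  apply: (cplx_eval st p); right.
    exists (re_part adj (g x)) => //; rewrite mem_cat; apply/orP; left.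
    by apply/mapP; exists x; rewrite ?mem_enum.
  exists (im_part cst adj (g x)) => //; rewrite mem_cat; apply/orP; right.
  by apply/mapP; exists x; rewrite ?mem_enum.
exists psi, e; split; split.
- exact: (cplxD st).
- exact: (cplxZ st).
- exact: (cplx1 adj_cst st).
- apply/eqP => psi0.
  have Lh : L h = c0.
    have := state_null st 1 (or_introl (or_intror erefl)).
    rewrite mulr1 (stateB st) -[real_scalar cst c0]mulr1 (stateZ st) (state1 st) mulr1.
    by move=> /eqP; rewrite subr_eq0 => /eqP.
  have : 0 < L h by rewrite Lh; exact: lt_le_trans h_gt0 c0h.
  have : psi h0 = 0 by rewrite /psi (cplxZ st) -/psi psi0 mulr0.
  rewrite /psi /cplx => -[Lh0 _].
  by rewrite (stateD st) (state_herm st) Lh0 addr0 ltxx.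
- by move=> x p; case: (ev x p).
- by move=> x p; case: (ev x p).
- move=> p hp; rewrite -[p]mulr1; apply: (cplx_null st).
  by left; left.
Qed.

(** * Unitary matrices separating a tensor from the algebra *)

Section Separation.
Context {R : realType} {n : nat}.
Local Notation C := R[i].
Local Notation T := (mtensor C n).
Local Notation AA := {malg C[{cmonom letter n}]}.
Context {A : set T} (ccgA : is_ccg_star_subalgebra A) (idA : A idtensor).
Context (P : biword n -> T) (PP : reproducing A P).
Local Open Scope sesquilinear_scope.

Definition scalars : {rmorphism C -> AA} := @malgC _ C.

Definition matrix_entry (ij : 'I_n * 'I_n) : AA := monomial [:: (false, ij)].

Lemma adj_matrix_entry ij : adj (matrix_entry ij) = monomial [:: (true, ij)].
Proof. exact: adj_monomial. Qed.

Lemma expectationD p q :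
  expectation P (p + q) = expectation P p + expectation P q.
Proof. exact: linear_extD. Qed.

Lemma expectationZ c p : expectation P (scalars c * p) = c * expectation P p.
Proof. exact: linear_extZ. Qed.

Lemma expectation1 : expectation P (1 : AA) = 1.
Proof.
rewrite -monomial_nil /expectation (linear_ext_monomial (moment_perm ccgA idA PP)).
exact: (moment_nil ccgA PP).
Qed.

(** The coefficients of the identity tensor are Kronecker symbols; with this the
    equations that fix it become the unitarity relations. *)
Lemma sum_id_bwords (V : lmodType C) (F : biword n -> V) :
  \sum_(y <- bwords (1, 1)%N) (idtensor : T)@_y *: F y = \sum_j F ([:: j], [:: j]).
Proof.
rewrite big_bwords -[(1, 1)%N.1]/1%N -[(1, 1)%N.2]/1%N big_wordsS.
apply: eq_bigr => j _.
rewrite big_words0 big_wordsS (bigD1 j) //= big_words0 mcoeff_idtensor eqxx scale1r.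
rewrite big1 ?addr0 // => i ij.
by rewrite big_words0 mcoeff_idtensor eq_sym (negbTE ij) scale0r.
Qed.

Lemma fix_equation_linear (E : AA -> C) (b : T) v p :
  (forall p q, E (p + q) = E p + E q) ->
  (forall c p, E (scalars c * p) = c * E p) ->
  E (fix_equation b v * p) =
  \sum_(y <- bwords (shape v)) b@_y * E (monomial (entries v y) * p) - b@_v * E p.
Proof.
exact: (@linear_relation _ _ scalars E _ _ (fun y => b@_y)
  (fun y => monomial (entries v y)) b@_v p).
Qed.

(** The rows of a unitary matrix have norm 1, so the entries are bounded; this
    extends to all polynomials. *)
Lemma bounded_expectation (p : AA) : bounded adj (expectation P) p.
Proof.
have bE (ij : 'I_n * 'I_n) : bounded adj (expectation P) (matrix_entry ij).
  case: ij => i j0.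
  apply: (@bounded_row _ _ scalars adj _ expectationD expectationZ
    (expectation_pos ccgA idA PP) _ (fun j => matrix_entry (i, j))) => q.
  pose v : biword n := ([:: i], [:: i]).
  have := etrans (esym (fix_equation_linear idtensor v q expectationD expectationZ))
    (fix_equation_null ccgA idA PP v q idA).
  rewrite (sum_id_bwords (V := C^o)) mcoeff_idtensor eqxx mul1r => /eqP.
  rewrite subr_eq0 => /eqP <-; apply: eq_bigr => j _.
  by rewrite adj_matrix_entry -monomial_cat.
have bX x : bounded adj (expectation P) (monomial [:: x]).
  case: x => [[] ij]; last exact: bE.
  by rewrite -adj_matrix_entry; apply: bounded_adj; [exact: adjK | exact: bE].
have bG s : bounded adj (expectation P) (monomial s).
  elim: s => [|x s IH].
    rewrite monomial_nil -(rmorph1 scalars).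
    exact: (@bounded_cst _ _ scalars adj adjC _ expectationZ).
  rewrite (_ : monomial (x :: s) = monomial [:: x] * monomial s); last by rewrite -monomial_cat.
  exact: boundedM (bX x) IH.
rewrite [p]malg_expand.
apply: (@bounded_sum _ _ scalars adj adjC _ expectationD expectationZ
   (expectation_pos ccgA idA PP)) => m.
apply: boundedM; last exact: bG.
by apply: (@bounded_cst _ _ scalars adj adjC _ expectationZ).
Qed.

(** The values of the generators under a character of the ring of polynomials in the
    entries that kills the relations of A but not that of z at v are the entries of
    the required matrix. *)
Lemma separation (z : T) v :
  \sum_(y <- bwords (shape v)) z@_y * ker P y v != z@_v ->
  exists2 U : 'M[C]_n, U \is unitarymx /\ (forall a, A a -> act U a = a)
    & act U z <> z.
Proof.
move=> zv.
have Eq : expectation P (fix_equation z v) != 0.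
  by rewrite (expectation_fix_equation ccgA idA PP) subr_eq0.
have [psi [e [[psiD psiZ psi1 psiq] [psig psig' psi0]]]] :=
  character_exists matrix_entry adjC adjK expectationD expectationZ expectation1
    (expectation_adj ccgA idA PP) (expectation_pos ccgA idA PP) bounded_expectation Eq.
pose U : 'M[C]_n := \matrix_(i, j) e (i, j).
pose V : 'M[C]_n := map_mx Num.conj U.
have psi_letters b (r : seq ('I_n * 'I_n)) p :
    psi (monomial [seq (b, ij) | ij <- r] * p) =
    (\prod_(ij <- r) (if b then Num.conj (e ij) else e ij)) * psi p.
  elim: r p => [|ij r IH] p; first by rewrite monomial_nil big_nil !mul1r.
  rewrite big_cons -mulrA -IH map_cons -cat1s monomial_cat -mulrA.
  by case: b {IH}; [rewrite -adj_matrix_entry; exact: psig' | exact: psig].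
have psi_entries (y w : biword n) :
    psi (monomial (entries y w) * 1) = entry_prod U y.1 w.1 * entry_prod V y.2 w.2.
  rewrite /entries monomial_cat -mulrA !psi_letters psi1 mulr1; congr (_ * _).
    by apply: eq_bigr => -[i j] _; rewrite mxE.
  by apply: eq_bigr => -[i j] _; rewrite !mxE.
have psi_fix_equation (b : T) w : psi (fix_equation b w) =
    \sum_(y <- bwords (shape w)) b@_y * (entry_prod U w.1 y.1 * entry_prod V w.2 y.2) - b@_w.
  rewrite -[fix_equation b w]mulr1 (fix_equation_linear b w 1 psiD psiZ).
  by rewrite psi1 mulr1; congr (_ - _); apply: eq_bigr => y _; rewrite psi_entries.
have fixA (b : T) w : A b ->
    \sum_(y <- bwords (shape w)) b@_y * (entry_prod U w.1 y.1 * entry_prod V w.2 y.2) = b@_w.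
  move=> Ab; apply/eqP; rewrite -subr_eq0 -psi_fix_equation psi0 // => p.
  exact: (fix_equation_null ccgA idA PP).
have uU : U *m U ^t* = 1%:M.
  apply/matrixP => i i'; have := fixA _ ([:: i], [:: i']) idA.
  rewrite (sum_id_bwords (V := C^o)) mcoeff_idtensor !mxE => <-.
  apply: eq_bigr => j _.
  by rewrite /= !entry_prod_cons /entry_prod !big_nil !mulr1 !mxE.
have VE : invmx U^T = V.
  have uV : U^T *m V = 1%:M.
    have := mulmx1C uU => /(congr1 trmx); rewrite trmx1 trmx_mul => <-.
    by congr (_ *m _); apply/matrixP => i j; rewrite !mxE.
  by rewrite -[LHS]mulmx1 -uV mulmxA mulVmx ?mul1mx //; case/mulmx1_unit: uV.
have actE (b : T) w : (act U b)@_w =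
    \sum_(y <- bwords (shape w)) b@_y * (entry_prod U w.1 y.1 * entry_prod V w.2 y.2).
  rewrite mcoeff_act; apply: eq_big_seq => y; rewrite mem_bwords => /eqP yw.
  by rewrite /act_coef yw eqxx VE.
exists U; first split.
- by apply/unitarymxP.
- by move=> a Aa; apply/malgP => w; rewrite actE fixA.
move=> zU; move: psiq; rewrite psi_fix_equation -actE zU subrr eqxx //.
Qed.

End Separation.

Theorem corollary1p2 (R : realType) (n : nat) (n_gt0 : (0 < n)%N)
    (S : set (mtensor R[i] n)) (G : set 'M[R[i]]_n)
    (starG : is_star_subgroup G)
    (leG : stabilizer unitary S `<=` G)
    (Gle : G `<=` stabilizer GL S) :
  invariants G = smallest is_ccg_star_subalgebra (S `|` [set idtensor]).
Proof.
have [[GU _ _ GV] Gstar] := starG.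
have ccgG : is_ccg_star_subalgebra (invariants G : set (mtensor R[i] n)).
  apply: invariants_ccg => // U HU.
  rewrite Gstar; exists (invmx U); first exact: GV.
  by rewrite trmx_inv map_invmx.
apply/seteqP; split; last first.
  apply: smallest_sub => // z [Sz|->] U HU; first exact: (Gle _ HU).2.
  by rewrite act_idtensor //; exact: GU.
move=> z Gz; set A := smallest _ _.
have ccgA : is_ccg_star_subalgebra A := smallest_ccg_star_subalgebra _.
have SA : S `|` [set idtensor] `<=` A by exact: sub_gen_smallest.
have idA : A idtensor by apply: SA; right.
have [P PP] := kernel_exists ccgA idA.
have [N zN] := hcomp_sum z; rewrite (zN N (leqnn N)).
case: (ccgA) => Aalg _ _ _.
apply: (@subalgebra_sum _ _ A _ _ _ Aalg) => k.
apply: (@subalgebra_sum _ _ A _ _ _ Aalg) => l.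
set x := hcomp k l z.
have Gx : invariants G x by move=> U HU; rewrite act_hcomp Gz.
apply: (ker_mem ccgA idA PP (s := (k : nat, l : nat))); first exact: hcomp_bihom.
move=> v vs; apply/eqP/negPn/negP => xv.
rewrite -vs in xv; have [U [uU UA] Ux] := separation ccgA idA PP xv.
apply: Ux; apply: (Gx U); apply: leG; split=> // s Ss.
by apply: UA; apply: SA; left.
Qed.
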